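(* For a graphing $\mathbf{G}=(J,\mathcal{B},E,\lambda)$ let its total rank be $$\overline{\rho}(\mathbf{G})=1-\mathsf{E}\Big(\frac{1}{|V(\mathbf{G}_{\mathbf{u}})|}\Big),$$ where $\mathbf{u}$ is a random point of $J$ with distribution $\lambda$ and $V(\mathbf{G}_u)$ is the node set of the connected component of $\mathbf{G}$ containing $u$ (with $1/\infty=0$); for a finite graph $G$ define $\overline{\rho}(G)$ analogously, with $\mathbf{u}$ a uniform random node of $G$. (a) The graphing parameter $\overline{\rho}$ is locally estimable. (b) If $G_1,G_2,\ldots$ is a sequence of finite graphs with all degrees bounded by $D\ge 0$ locally converging to a graphing $\mathbf{G}$, then $\overline{\rho}(G_n)\to\overline{\rho}(\mathbf{G})$ as $n\to\infty$.
   Context: A graphing is a quadruple $\mathbf{G}=(J,\mathcal{B},E,\lambda)$, where $(J,\mathcal{B})$ is a standard Borel space, $\lambda$ is a probability measure on $\mathcal{B}$, and $E$ is a Borel set of unordered pairs of distinct points of $J$ (identified with a symmetric Borel subset of $J\times J$ disjoint from the diagonal), such that all degrees of the graph $(J,E)$ are bounded by a finite integer and $$\int_A \deg_B(x)\,d\lambda(x)=\int_B \deg_A(x)\,d\lambda(x)\qquad\text{for all }A,B\in\mathcal{B},$$ where $\deg_B(x)$ is the number of edges from $x$ to points of $B$. A finite graph with the uniform distribution on its nodes is a special case. For a node $x$ and an integer $r\ge1$, $B_r(x)$ denotes the $r$-ball centered at $x$: the subgraph induced by the nodes at graph distance at most $r$ from $x$, regarded as a finite rooted graph with root $x$, up to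 rooted isomorphism. A graphing parameter $f$ (a real-valued function of graphings) is locally estimable if for every error bound $\varepsilon>0$ and degree bound $D\ge0$ there are integers $k,r\ge1$ depending only on $\varepsilon$ and $D$ such that for any graphing $\mathbf{G}=(J,\mathcal{B},E,\lambda)$ with maximum degree (at most) $D$, selecting $k$ independent random nodes $x_1,\dots,x_k$ from $\lambda$ and considering their neighborhoods $B_r(x_1),\dots,B_r(x_k)$, one can compute from these neighborhoods (i.e. as a function, depending only on $\varepsilon$ and $D$, of the $k$-tuple of isomorphism types of rooted graphs $B_r(x_1),\dots,B_r(x_k)$) an estimate $R$ of $f(\mathbf{G})$ such that $\Pr\big(|R-f(\mathbf{G})|\ge\varepsilon\big)\le\varepsilon$. This applies in particular to finite graphs. A sequence of finite graphs $G_n$ with all degrees bounded by $D$ is said to locally converge to a graphing $\mathbf{G}$ if for every $r\ge1$, the distribution of the $r$-ball (up to rooted isomorphism) centered at a uniform random node of $G_n$ converges, as $n\to\infty$, to the distribution of the $r$-ball centered at a random point of $\mathbf{G}$ chosen from $\lambda$. *)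

(* Defs.v *)
From HB Require Import structures.
From mathcomp Require Import all_boot all_order all_algebra.
From mathcomp Require Import all_classical all_reals all_analysis.

Set Implicit Arguments.
Unset Strict Implicit.
Unset Printing Implicit Defensive.

Import Order.TTheory GRing.Theory Num.Theory.
Import numFieldNormedType.Exports.

Local Open Scope classical_set_scope.
Local Open Scope ring_scope.

(* Uniformly random nodes are chosen from finite graphs, so they are nonempty. *)
Record fin_graph := FinGraph {
  fg_node : finType;
  fg_adj : rel fg_node;
  fg_adj_sym : symmetric fg_adj;
  fg_adj_irr : irreflexive fg_adj;
  fg_node_gt0 : (0 < #|fg_node|)%N }.

Record rooted_graph := RootedGraph {
  rg_order : nat;
  rg_adj : rel 'I_rg_order;
  rg_adj_sym : symmetric rg_adj;
  rg_adj_irr : irreflexive rg_adj;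
  rg_root : 'I_rg_order }.

Section neighborhoods.
Context {T : eqType} (e : rel T).

Definition component (x : T) : set T :=
  [set y | exists p : seq T, path e x p /\ last x p = y].

Definition graph_ball (r : nat) (x : T) : set T :=
  [set y | exists p : seq T, [/\ path e x p, last x p = y & (size p <= r)%N]].

(* The rooted isomorphism type of B_r(x) is represented by the class of all
   rooted graphs on some 'I_n isomorphic to the subgraph induced on the r-ball; so two
   r-balls are isomorphic if and only if their types are equal. *)
Definition ball_type (r : nat) (x : T) : set rooted_graph :=
  [set H | exists phi : 'I_(rg_order H) -> T,
     [/\ injective phi, phi (rg_root H) = x, range phi = graph_ball r x &
         forall i j, rg_adj i j = e (phi i) (phi j)]].

End neighborhoods.

(* Borel isomorphic to a complete separable metric space. *)
Definition standard_borel (R : realType) (d : measure_display)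
    (T : measurableType d) : Prop :=
  exists (M : metricType R) (f : T -> M),
    [/\ (forall F : set_system M, ProperFilter F -> cauchy F ->
           exists l : M, F --> l),
        (exists2 S : set M, countable S & dense S),
        bijective f &
        forall A : set M, <<s [set U : set M | open U] >> A <->
                          measurable (f @^-1` A)].

Definition set_deg (R : realType) (T : choiceType) (E : set (T * T))
    (B : set T) (x : T) : \bar R :=
  counting (xsection E x `&` B).

Record graphing (R : realType) := Graphing {
  gr_display : measure_display;
  gr_node : measurableType gr_display;
  gr_edge : set (gr_node * gr_node);
  gr_prob : probability gr_node R;
  gr_standard : standard_borel R gr_node;
  gr_edge_measurable : measurable gr_edge;
  gr_edge_sym : forall x y, gr_edge (x, y) -> gr_edge (y, x);
  gr_edge_irr : forall x, ~ gr_edge (x, x);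
  gr_bounded_deg : exists D : nat,
    forall x, (set_deg R gr_edge setT x <= D%:R%:E)%E;
  gr_measure_preserving : forall A B : set gr_node,
    measurable A -> measurable B ->
    (\int[gr_prob]_(x in A) set_deg R gr_edge B x =
     \int[gr_prob]_(x in B) set_deg R gr_edge A x)%E }.

Definition gr_adj (R : realType) (G : graphing R) : rel (gr_node G) :=
  fun x y => (x, y) \in @gr_edge R G.

Definition gr_deg_le (R : realType) (G : graphing R) (D : nat) : Prop :=
  forall x, (set_deg R (@gr_edge R G) setT x <= D%:R%:E)%E.

Definition fg_deg_le (G : fin_graph) (D : nat) : Prop :=
  forall x : fg_node G, (#|[pred y | fg_adj x y]| <= D)%N.

(* Since inve +oo = 0 on \bar R, infinite components contribute 0. *)
Definition total_rank (R : realType) (G : graphing R) : R :=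
  1 - fine (\int[@gr_prob R G]_u
              (counting (component (@gr_adj R G) u))^-1)%E.

Definition fg_total_rank (R : realType) (G : fin_graph) : R :=
  1 - (\sum_(u : fg_node G) (#|connect (@fg_adj G) u|%:R)^-1)
      / #|fg_node G|%:R.

Definition iid_sample (R : realType) (d d' : measure_display)
    (W : measurableType d) (P : probability W R)
    (T : measurableType d') (lambda : probability T R)
    (k : nat) (X : 'I_k -> {RV P >-> T}) : Prop :=
  (forall i (A : set T), measurable A -> distribution P (X i) A = lambda A) /\
  (forall A : 'I_k -> set T, (forall i, measurable (A i)) ->
     P (\bigcap_i (X i @^-1` A i)) = (\prod_(i < k) P (X i @^-1` A i))%E).

Definition locally_estimable (R : realType) (f : graphing R -> R) : Prop :=
  forall (eps : R) (D : nat), 0 < eps ->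
  exists (k r : nat) (est : ('I_k -> set rooted_graph) -> R),
    [/\ (1 <= k)%N, (1 <= r)%N &
    forall G : graphing R, gr_deg_le G D ->
    forall (d : measure_display) (W : measurableType d) (P : probability W R)
           (X : 'I_k -> {RV P >-> gr_node G}),
      iid_sample (@gr_prob R G) X ->
      (P [set w | (eps <= `| est (fun i => ball_type (@gr_adj R G) r (X i w))
                             - f G |)%R] <= eps%:E)%E].

Definition fg_ball_prob (R : realType) (G : fin_graph) (r : nat)
    (H : rooted_graph) : R :=
  #|[pred x : fg_node G | `[< ball_type (@fg_adj G) r x H >]]|%:R
  / #|fg_node G|%:R.

Definition gr_ball_prob (R : realType) (G : graphing R) (r : nat)
    (H : rooted_graph) : R :=
  fine (@gr_prob R G [set x | ball_type (@gr_adj R G) r x H]).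

(* For graphs of bounded degree only finitely many types of r-balls occur, so
   convergence of the distributions is convergence of each probability. *)
Definition locally_converges (R : realType) (Gs : nat -> fin_graph)
    (G : graphing R) : Prop :=
  forall r : nat, (1 <= r)%N -> forall H : rooted_graph,
    fg_ball_prob R (Gs n) r H @[n --> \oo] --> gr_ball_prob G r H.

(* Main.v *)
Require Import Defs.
From HB Require Import structures.
From mathcomp Require Import finmap all_boot all_order all_algebra.
From mathcomp Require Import all_classical all_reals all_analysis.
From mathcomp Require Import measurable_realfun lra.
Import Order.TTheory GRing.Theory Num.Theory.
Import numFieldNormedType.Exports.
Set Implicit Arguments.
Unset Strict Implicit.
Unset Printing Implicit Defensive.
Local Open Scope classical_set_scope.
Local Open Scope ring_scope.

(** If the r-ball around x is not the whole component of x then it has more than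
    r nodes. Hence [1/|B_r(x)|] approximates [1/|V(G_x)|] within [1/(r+1)],
    uniformly in x, and the total rank is determined up to [1/(r+1)] by the
    distribution of r-balls, which takes finitely many values when degrees are
    bounded. This gives (b) directly, and (a) follows by sampling r-balls and
    Chebyshev's inequality.

    The sets of nodes with a given type of r-ball must be measurable, although the
    edge set is only assumed to be Borel; without this, their probabilities would
    be meaningless. This is an instance of the Lusin-Novikov theorem: a Borel set
    in the plane with sections of at most D points is covered by the graphs of
    countably many Borel functions. It rests on Lusin's separation theorem for
    analytic sets. Balls are then obtained by composing these functions. *)

(** * Measurability of conditions built with countable quantifiers *)

Section measurable_formulas.
Context (d : measure_display) (T : measurableType d).

Lemma measurable_const_prop (P : Prop) : measurable [set _ : T | P].
Proof.
have [p|p] := pselect P.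
  by rewrite (_ : mkset _ = setT)//; apply/seteqP; split.
by rewrite (_ : mkset _ = set0)//; apply/seteqP; split.
Qed.

Lemma measurable_imply (P : Prop) (Q : set T) :
  measurable Q -> measurable [set x | P -> Q x].
Proof.
move=> mQ; have [p|p] := pselect P.
  by rewrite (_ : mkset _ = Q)//; apply/seteqP; split=> x /=; [exact|].
by rewrite (_ : mkset _ = setT)//; apply/seteqP; split=> // x _ /p.
Qed.

Lemma countable_bigcap_measurable (I : countType) (F : I -> set T) :
  (forall i, measurable (F i)) -> measurable (\bigcap_i F i).
Proof.
move=> mF; rewrite -[X in measurable X]setCK; apply: measurableC.
rewrite setC_bigcap; apply: countable_bigcupT_measurable => // i.
exact: measurableC.
Qed.

Lemma measurable_forall (I : countType) (P : I -> T -> Prop) :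
  (forall i, measurable [set x | P i x]) -> measurable [set x | forall i, P i x].
Proof.
move=> mP; rewrite (_ : mkset _ = \bigcap_i [set x | P i x]).
  exact: countable_bigcap_measurable.
by apply/seteqP; split=> x hx i; [move=> _; exact: hx|exact: hx].
Qed.

Lemma measurable_exists (I : countType) (P : I -> T -> Prop) :
  (forall i, measurable [set x | P i x]) -> measurable [set x | exists i, P i x].
Proof.
move=> mP; rewrite (_ : mkset _ = \bigcup_i [set x | P i x]).
  exact: countable_bigcupT_measurable.
by apply/seteqP; split=> x [i]; exists i.
Qed.

End measurable_formulas.

(** * Analytic sets and Lusin separation *)

Definition agree (n : nat) (a b : nat -> nat) := forall k, (k < n)%N -> a k = b k.

Lemma agreeW m n a b : (m <= n)%N -> agree n a b -> agree m a b.
Proof. by move=> mn ab k km; apply: ab; apply: leq_trans mn. Qed.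

(** Reindexing is continuous: the first [n] entries of [a \o h] consult only finitely many entries
    of [a]. *)
Lemma agree_comp (h : nat -> nat) n : exists N, forall a b,
  agree N a b -> agree n (a \o h) (b \o h).
Proof.
exists (\max_(k < n) (h k).+1)%N => a b ab k kn; apply: ab.
exact: (@leq_bigmax _ (fun k : 'I_n => (h k).+1) (Ordinal kn)).
Qed.

Section analytic.
Context {N : Type} (O : set (set N)).

Definition hausdorff_family := forall x y : N, x <> y ->
  exists U V : set N, [/\ O U, O V, U x, V y & U `&` V = set0].

(* A is the projection of a set F which, with O as the basic open sets of N, is
   closed in N x omega^omega in a strong sense: along any sequence a that is a
   limit of second components, F concentrates near one point of A. *)
Definition analytic (A : set N) := exists F : set (N * (nat -> nat)),
  (forall x, A x <-> exists a, F (x, a)) /\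
  forall a, (forall n, exists y b, F (y, b) /\ agree n b a) ->
    exists2 x, A x & forall U, O U -> U x ->
      exists n, forall y b, F (y, b) -> agree n b a -> U y.

Lemma analytic0 : analytic set0.
Proof.
exists set0; split=> [x|a h]; first by split=> // -[].
by have [y [b []]] := h 0.
Qed.

(** The first entry of the new code names an index [i], and the remaining entries form a code for
    membership in [A i]. *)
Lemma analytic_bigcup (A : nat -> set N) :
  (forall i, analytic (A i)) -> analytic (\bigcup_i A i).
Proof.
move=> /choice[F hF].
exists [set p : N * (nat -> nat) | F (p.2 0%N) (p.1, p.2 \o succn)]; split=> [x|a h].
  split=> [[i _ Aix]|[a /= Fx]].
    have [a Fa] := ((hF i).1 x).1 Aix.
    by exists (fun k => if k is k'.+1 then a k' else i).
  by exists (a 0) => //; apply/((hF _).1 x); exists (a \o succn).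
have [|x Ax hx] := (hF (a 0)).2 (a \o succn).
  move=> n; have [y [b [Fb ba]]] := h n.+1.
  exists y, (b \o succn); split; last by move=> k kn; apply: ba.
  by move: Fb; rewrite /= ba.
exists x; first by exists (a 0).
move=> U OU Ux; have [n hn] := hx U OU Ux.
exists n.+1 => y b /= Fb ba; apply: (hn y (b \o succn)).
  by move: Fb; rewrite ba.
by move=> k kn; apply: ba.
Qed.

Lemma analyticU A B : analytic A -> analytic B -> analytic (A `|` B).
Proof.
move=> hA hB; rewrite -bigcup2E; apply: analytic_bigcup => -[|[|i]] //=.
exact: analytic0.
Qed.

(** One sequence carries codes for all the [A i], the [i]-th being read along the column [h i]. Each
    column has its own limit point. These limits coincide, because disjoint neighbourhoods of two of
    them would both contain a point whose code agrees with [a] far enough. *)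
Lemma analytic_bigcap (A : nat -> set N) : hausdorff_family ->
  (forall i, analytic (A i)) -> analytic (\bigcap_i A i).
Proof.
move=> hO /choice[F hF].
pose h (i k : nat) := pickle (i, k).
exists [set p : N * (nat -> nat) | forall i, F i (p.1, p.2 \o h i)]; split=> [x|a hyp].
  split=> [Ax|[a /= Fx]].
    have /choice[c hc] : forall i, exists a, F i (x, a).
      by move=> i; apply/((hF i).1 x); exact: Ax.
    exists (fun m => if unpickle m is Some p then c p.1 p.2 else 0%N) => i /=.
    rewrite (_ : _ \o _ = c i) //.
    by apply/funext => k; rewrite /= /h pickleK.
  by move=> i _; apply/((hF i).1 x); exists (a \o h i).
have /choice[x hx] : forall i, exists x, A i x /\
    (forall U, O U -> U x ->
      exists n, forall y b, F i (y, b) -> agree n b (a \o h i) -> U y).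
  move=> i; have [|x] := (hF i).2 (a \o h i); last by exists x.
  move=> n; have [M hM] := agree_comp (h i) n.
  have [y [b [Fb /hM ba]]] := hyp M.
  by exists y, (b \o h i); split=> //; exact: Fb.
have xE i : x i = x 0%N.
  apply: contrapT => /hO[U [V [OU OV Ux Vx UV]]].
  have [n hn] := (hx i).2 U OU Ux; have [m hm] := (hx 0).2 V OV Vx.
  have [n' hn'] := agree_comp (h i) n; have [m' hm'] := agree_comp (h 0) m.
  have [y [b [Fb ba]]] := hyp (maxn n' m').
  suff : (U `&` V) y by rewrite UV.
  split.
    by apply: hn (Fb i) _; apply/hn'/(agreeW _ ba)/leq_maxl.
  by apply: hm (Fb 0) _; apply/hm'/(agreeW _ ba)/leq_maxr.
exists (x 0); first by move=> i _; rewrite -(xE i); exact: (hx i).1.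
move=> U OU Ux; have [n hn] := (hx 0).2 U OU Ux.
have [n' hn'] := agree_comp (h 0) n.
by exists n' => y b Fb /hn'; apply: hn; exact: (Fb 0).
Qed.

Lemma analyticI A B : hausdorff_family ->
  analytic A -> analytic B -> analytic (A `&` B).
Proof.
move=> hO hA hB; have := @analytic_bigcap (fun i => if i is 0 then A else B) hO.
rewrite (_ : \bigcap_i _ = A `&` B); first by apply; case.
apply/seteqP; split=> [x h|x [Ax Bx] [|i] //].
by split; [exact: (h 0)|exact: (h 1)].
Qed.

(** Symmetry under complements is built in, and countable unions need both closure properties of
    analytic sets. It follows that every measurable set is analytic as soon as the generators are
    bianalytic. *)
Lemma bianalytic_sigma_algebra : hausdorff_family -> analytic setT ->
  sigma_algebra setT [set A | analytic A /\ analytic (~` A)].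
Proof.
move=> hO aT; split.
- by split; [exact: analytic0|rewrite setC0].
- by move=> A [? ?]; split; rewrite setTD ?setCK.
- move=> A hA; split; first by apply: analytic_bigcup => i; have [] := hA i.
  by rewrite setC_bigcup; apply: analytic_bigcap => // i; have [] := hA i.
Qed.

End analytic.

Section separation.
Context (d : measure_display) (T : measurableType d) (O : set (set T)).

Definition separated_by_measurable (A B : set T) :=
  exists C, [/\ measurable C, A `<=` C & B `&` C = set0].

(** Used contrapositively: if two countable unions cannot be separated, neither can some pair of
    their pieces. *)
Lemma separated_bigcup (A B : nat -> set T) :
  (forall i j, separated_by_measurable (A i) (B j)) ->
  separated_by_measurable (\bigcup_i A i) (\bigcup_j B j).
Proof.
move=> sep; have /choice[C hC] i : exists C : nat -> set T, forall j,
    [/\ measurable (C j), A i `<=` C j & B j `&` C j = set0].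
  by have /choice[C hC] := sep i; exists C.
exists (\bigcup_i \bigcap_j C i j); split.
- apply: bigcupT_measurable => i; apply: bigcapT_measurable => j.
  by have [] := hC i j.
- by move=> x [i _ Ax]; exists i => // j _; have [_ + _] := hC i j; exact.
- rewrite -subset0 => x [[j _ Bx] [i _ /(_ j I) Cx]].
  by have [_ _ <-] := hC i j.
Qed.

(* If A and B were not separated, one could shrink both along a pair of
   branches while remaining nonseparated; the limits of the branches are
   distinct, so disjoint neighbourhoods separate them after finitely many
   steps. *)
Lemma lusin_separation (A B : set T) : O `<=` measurable ->
  hausdorff_family O -> analytic O A -> analytic O B -> A `&` B = set0 ->
  separated_by_measurable A B.
Proof.
move=> mO hO [F [FA hF]] [G [GB hG]] AB; apply: contrapT => nsep.
(* The points that have a code in [K] beginning with the word [s]. *)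
pose tr (K : set (T * (nat -> nat))) (s : seq nat) :=
  [set y | exists b, K (y, b) /\ mkseq b (size s) = s].
have trS K s : tr K s = \bigcup_i tr K (rcons s i).
  apply/seteqP; split=> y.
    move=> [b [Kb bs]]; exists (b (size s)) => //; exists b; split=> //.
    by rewrite size_rcons mkseqS bs.
  move=> [i _ [b [Kb]]]; rewrite size_rcons mkseqS => /rcons_inj[bs _].
  by exists b.
(* Stating the property as an implication makes the step total, so that it can be chosen once for
   all pairs of words. *)
have /choice[step hstep] : forall p : seq nat * seq nat, exists ij : nat * nat,
    ~ separated_by_measurable (tr F p.1) (tr G p.2) ->
    ~ separated_by_measurable (tr F (rcons p.1 ij.1)) (tr G (rcons p.2 ij.2)).
  move=> [s t]; apply: contrapT => /forallNP h.
  have sep i j : separated_by_measurable (tr F (rcons s i)) (tr G (rcons t j)).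
    by apply: contrapT => nij; apply: (h (i, j)).
  apply: (h (0, 0)%N) => /= -[]; rewrite (trS F) (trS G).
  exact: separated_bigcup.
pose st := fix st n := if n is n'.+1
  then (rcons (st n').1 (step (st n')).1, rcons (st n').2 (step (st n')).2)
  else ([::], [::]).
have nst n : ~ separated_by_measurable (tr F (st n).1) (tr G (st n).2).
  elim: n => [|n IHn] /=; last exact: hstep.
  suff [-> ->] : tr F [::] = A /\ tr G [::] = B by [].
  split; apply/seteqP; split=> y.
  - by move=> [b [Fb _]]; apply/(FA y); exists b.
  - by move=> /(FA y)[b Fb]; exists b.
  - by move=> [b [Gb _]]; apply/(GB y); exists b.
  - by move=> /(GB y)[b Gb]; exists b.
pose a n := (step (st n)).1; pose b n := (step (st n)).2.
have aE n : (st n).1 = mkseq a n by elim: n => //= n ->; rewrite mkseqS.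
have bE n : (st n).2 = mkseq b n by elim: n => //= n ->; rewrite mkseqS.
have trP (K : set (T * (nat -> nat))) (c : nat -> nat) n y :
    tr K (mkseq c n) y <-> exists c', K (y, c') /\ agree n c' c.
  split=> -[c' [Kc' cc']]; exists c'; split=> //.
    move=> k kn; have := congr1 (nth 0%N ^~ k) cc'.
    by rewrite size_mkseq !nth_mkseq.
  rewrite size_mkseq; apply: (@eq_from_nth _ 0%N); rewrite !size_mkseq //.
  by move=> k kn; rewrite !nth_mkseq // cc'.
(* Both pieces of a nonseparated pair are nonempty, since otherwise [set0] or [setT] would separate
   them; so each branch has a limit. *)
have [|x Ax hx] := hF a.
  move=> n; apply: contrapT => /forallNP hn; apply: (nst n).
  exists set0; split=> //; rewrite ?setI0 // aE => y /trP[c' ?].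
  by case: (hn y); exists c'.
have [|y By hy] := hG b.
  move=> n; apply: contrapT => /forallNP hn; apply: (nst n).
  exists setT; split=> //; rewrite setIT -subset0 bE => y /trP[c' ?].
  by case: (hn y); exists c'.
have /hO[U [V [OU OV Ux Vy UV]]] : x <> y.
  move=> xy; have : (A `&` B) x by split=> //; rewrite xy.
  by rewrite AB.
have [n hn] := hx U OU Ux; have [m hm] := hy V OV Vy.
apply: (nst (maxn n m)); exists U; split; first exact: mO.
  rewrite aE => z /trP[c [Fc ca]]; apply: hn Fc _.
  exact: agreeW (leq_maxl _ _) ca.
rewrite -subset0 -UV bE => z [/trP[c [Gc cb]] Uz]; split=> //.
by apply: hm Gc _; exact: agreeW (leq_maxr _ _) cb.
Qed.

End separation.

(** * Analytic sets in products, and projections *)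

Section products.
Context {S T : Type} (OS : set (set S)) (OT : set (set T)).

(** A subbasis of the product topology suffices: limits are tested against one open set at a time,
    and distinct pairs already differ in one coordinate. *)
Definition cylinders : set (set (S * T)) :=
  [set fst @^-1` U | U in OS] `|` [set snd @^-1` V | V in OT].

Lemma cylinders_hausdorff :
  hausdorff_family OS -> hausdorff_family OT -> hausdorff_family cylinders.
Proof.
move=> hS hT [x y] [x' y'] ne.
have [xx|/hS[U [V [OU OV Ux Vx UV]]]] := pselect (x = x').
  have /hT[U [V [OU OV Ux Vx UV]]] : y <> y' by move=> yy; apply: ne; rewrite xx yy.
  exists (snd @^-1` U), (snd @^-1` V); split=> //; [by right; exists U|by right; exists V|].
  by rewrite -preimage_setI UV.
exists (fst @^-1` U), (fst @^-1` V); split=> //; [by left; exists U|by left; exists V|].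
by rewrite -preimage_setI UV.
Qed.

(** A code of a pair also serves as a code of its first coordinate, and the limit clause for [E]
    supplies both coordinates of the limit. *)
Lemma analytic_fst (E : set (S * T)) :
  analytic cylinders E -> analytic OS (fst @` E).
Proof.
move=> [F [FE hF]].
exists [set p : S * (nat -> nat) | exists y, F ((p.1, y), p.2)]; split=> [x|a h].
  split=> [[[x' y] /FE[a Fa] <-]|[a [y Fy]]]; first by exists a, y.
  by exists (x, y) => //; apply/FE; exists a.
have [|[x y] Exy hxy] := hF a.
  by move=> n; have [x [b [[y Fy] ba]]] := h n; exists (x, y), b.
exists x; first by exists (x, y).
move=> U OU Ux; have [||n hn] := hxy (fst @^-1` U); [by left; exists U|by []|].
by exists n => x' b [y' Fy'] /(hn _ _ Fy').
Qed.

Lemma analyticX (A : set S) (B : set T) :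
  analytic OS A -> analytic OT B -> analytic cylinders (A `*` B).
Proof.
move=> [F [FA hF]] [G [GB hG]].
pose h (c : bool) (k : nat) := pickle (c, k).
exists [set p : S * T * (nat -> nat) | F (p.1.1, p.2 \o h true) /\ G (p.1.2, p.2 \o h false)].
split=> [[x y]|a hyp].
  split=> [[/= /FA[a Fa] /GB[b Gb]]|[a /= [Fa Gb]]].
    exists (fun m => if unpickle m is Some p then
      if p.1 then a p.2 else b p.2 else 0%N) => /=.
    rewrite (_ : _ \o h true = a) 1?(_ : _ \o h false = b) //;
      by apply/funext => k; rewrite /= /h pickleK.
  by split=> /=; [apply/FA; exists (a \o h true)|apply/GB; exists (a \o h false)].
have [|x Ax hx] := hF (a \o h true).
  move=> n; have [M hM] := agree_comp (h true) n.
  by have [[x y] [b [[Fb Gb] /hM ba]]] := hyp M; exists x, (b \o h true).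
have [|y By hy] := hG (a \o h false).
  move=> n; have [M hM] := agree_comp (h false) n.
  by have [[x' y] [b [[Fb Gb] /hM ba]]] := hyp M; exists y, (b \o h false).
exists (x, y) => // W [] [U OU <-] Ux.
  have [n hn] := hx U OU Ux; have [M hM] := agree_comp (h true) n.
  by exists M => -[x' y'] b [Fb _] /hM; exact: hn.
have [n hn] := hy U OU Ux; have [M hM] := agree_comp (h false) n.
by exists M => -[x' y'] b [_ Gb] /hM; exact: hn.
Qed.

End products.

(** * Polish distances *)

Section polish.
Context (R : realType) (d : measure_display) (T : measurableType d).
Context (dist : T -> T -> R) (q : nat -> T).

Definition rad n : R := n.+1%:R^-1.

Lemma rad_gt0 n : 0 < rad n. Proof. by rewrite /rad invr_gt0 ltr0n. Qed.

Lemma rad_lt (e : R) : 0 < e -> exists n, rad n < e.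
Proof.
move=> e0; have [n _ hn] := near_infty_natSinv_lt (PosNum e0).
by exists n; apply: (hn n) => /=.
Qed.

Definition basic_ball (p : nat * nat) : set T := [set y | dist (q p.1) y < rad p.2].

(** A complete separable metric, stated by inequalities because [T] carries only a sigma-algebra.
    Completeness concerns sequences with the fixed Cauchy rate [rad] and returns a limit with the
    same rate. The last two fields say that the countably many basic balls generate the measurable
    sets. *)
Record polish_dist : Prop := PolishDist {
  distxx : forall x, dist x x = 0;
  dist_eq0 : forall x y, dist x y = 0 -> x = y;
  distC : forall x y, dist x y = dist y x;
  dist_triangle : forall y x z, dist x z <= dist x y + dist y z;
  dist_dense : forall x e, 0 < e -> exists i, dist (q i) x < e;
  dist_complete : forall u : nat -> T,
    (forall n m, dist (u n) (u m) < rad n + rad m) ->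
    exists l, forall n, dist (u n) l <= rad n;
  measurable_basic_ball : forall p, measurable (basic_ball p);
  measurable_gen_basic_ball : forall A, measurable A -> <<s range basic_ball >> A }.

Hypothesis pd : polish_dist.

Lemma dist_ge0 x y : 0 <= dist x y.
Proof.
have := dist_triangle pd y x x.
by rewrite (distxx pd) (distC pd y x) -mulr2n pmulrn_lge0.
Qed.

Lemma dist_gt0 x y : x <> y -> 0 < dist x y.
Proof.
move=> xy; rewrite lt_neqAle dist_ge0 andbT eq_sym.
by apply/eqP => /(dist_eq0 pd).
Qed.

Lemma basic_ball_nbhs x e : 0 < e ->
  exists p, basic_ball p x /\ forall y, basic_ball p y -> dist x y < e.
Proof.
move=> e0; have [n hn] := rad_lt (divr_gt0 e0 (ltr0n _ 2)).
have [i hi] := dist_dense pd x (rad_gt0 n).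
exists (i, n); split=> //= y; rewrite /basic_ball /= => hy.
have := dist_triangle pd (q i) x y; rewrite (distC pd x (q i)).
by move: hi hn hy; lra.
Qed.

Lemma basic_ball_hausdorff : hausdorff_family (range basic_ball).
Proof.
move=> x y /dist_gt0 xy; have e0 : 0 < dist x y / 2 by rewrite divr_gt0.
have [p [px hp]] := basic_ball_nbhs x e0; have [p' [py hp']] := basic_ball_nbhs y e0.
exists (basic_ball p), (basic_ball p'); split=> //.
rewrite -subset0 => z [/hp xz /hp' yz].
by have := dist_triangle pd z x y; rewrite (distC pd z y); lra.
Qed.

(** A code of [x] lists centres [q (a n)] within [rad n] of [x]. If every prefix of [a] is realised
    by a point of [C], these centres are Cauchy at rate [rad], and their limit is in the closed set
    [C]. *)
Lemma dclosed_analytic (C : set T) :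
  (forall l, (forall e, 0 < e -> exists2 y, C y & dist y l < e) -> C l) ->
  analytic (range basic_ball) C.
Proof.
move=> cC.
exists [set p : T * (nat -> nat) | C p.1 /\ forall n, basic_ball (p.2 n, n) p.1].
split=> [x|a h].
  split=> [Cx|[a []]//].
  have /choice[a ha] n := dist_dense pd x (rad_gt0 n).
  by exists a.
have [|l hl] := @dist_complete pd (fun n => q (a n)).
  move=> n m; have [y [b [[_ yb] ba]]] := h (maxn n m).+1.
  have yn := yb n; have ym := yb m.
  rewrite /= !ba ?ltnS ?leq_maxl ?leq_maxr // /basic_ball /= in yn ym.
  apply: le_lt_trans (dist_triangle pd y _ _) _.
  by rewrite (distC pd y); apply: ltrD.
exists l.
  apply: cC => e e0; have [n hn] := rad_lt (divr_gt0 e0 (ltr0n _ 2)).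
  have [y [b [[Cy /(_ n) yb] ba]]] := h n.+1.
  rewrite /= ba // /basic_ball /= in yb; exists y => //.
  have := dist_triangle pd (q (a n)) y l; have := hl n.
  by rewrite (distC pd y (q (a n))); lra.
move=> _ [[i m] _ <-]; rewrite /basic_ball /= => il.
(* Half of the slack at [l]: a point with a long enough matching code is within [rad n] of
   [q (a n)], which is itself within [rad n] of [l]. *)
have e0 : 0 < (rad m - dist (q i) l) / 2 by rewrite divr_gt0 // subr_gt0.
have [n hn] := rad_lt e0; exists n.+1 => y b [/= _ /(_ n) yb] ba.
rewrite /= ba // /basic_ball /= in yb.
have := dist_triangle pd l (q i) y; have := dist_triangle pd (q (a n)) l y.
by have := hl n; rewrite (distC pd (q (a n)) l); lra.
Qed.

Lemma analyticT : analytic (range basic_ball) setT.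
Proof. exact: dclosed_analytic. Qed.

(** The complement of an open ball is closed, and the ball is a countable union of closed balls of
    smaller radius. *)
Lemma bianalytic_basic_ball p :
  analytic (range basic_ball) (basic_ball p) /\ analytic (range basic_ball) (~` basic_ball p).
Proof.
split; last first.
  apply: dclosed_analytic => l hl; rewrite /basic_ball /=.
  apply/negP; rewrite -leNgt; apply/ler_addgt0Pr => e e0.
  have [y + yl] := hl e e0; rewrite /basic_ball /= => /negP; rewrite -leNgt => qy.
  by have := dist_triangle pd l (q p.1) y; rewrite (distC pd l y); lra.
rewrite (_ : basic_ball p = \bigcup_n [set y | dist (q p.1) y <= rad p.2 - rad n]).
  apply: analytic_bigcup => n; apply: dclosed_analytic => l hl /=.
  apply/ler_addgt0Pr => e e0.
  have [y /= qy yl] := hl e e0.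
  by have := dist_triangle pd y (q p.1) l; lra.
apply/seteqP; split=> y; rewrite /basic_ball /=.
  rewrite -subr_gt0 => /rad_lt[n hn]; exists n => //=; lra.
by move=> [n _] /=; have := rad_gt0 n; lra.
Qed.

Lemma measurable_analytic (A : set T) : measurable A -> analytic (range basic_ball) A.
Proof.
move=> /(measurable_gen_basic_ball pd) mA.
have sa := bianalytic_sigma_algebra basic_ball_hausdorff analyticT.
have : range basic_ball `<=` [set A | analytic (range basic_ball) A /\
    analytic (range basic_ball) (~` A)].
  by move=> _ [p _ <-]; exact: bianalytic_basic_ball.
by move=> /(smallest_sub sa)/(_ _ mA)[].
Qed.

(** Measurable rectangles generate the product sigma-algebra and are bianalytic: the complement of a
    rectangle is the union of two rectangles. *)
Lemma measurable_prod_analytic (E : set (T * T)) : measurable E ->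
  analytic (cylinders (range basic_ball) (range basic_ball)) E.
Proof.
rewrite measurable_prod_measurableType => mE.
set O := cylinders _ _.
have hO : hausdorff_family O.
  by apply: cylinders_hausdorff; exact: basic_ball_hausdorff.
have aT : analytic O setT by rewrite -setXTT; apply: analyticX; exact: analyticT.
have sa := bianalytic_sigma_algebra hO aT.
suff : [set A `*` B | A in d.-measurable & B in d.-measurable]
    `<=` [set A | analytic O A /\ analytic O (~` A)].
  by move=> /(smallest_sub sa)/(_ _ mE)[].
move=> _ [A mA [B mB <-]]; split.
  by apply: analyticX; exact: measurable_analytic.
rewrite (_ : ~` _ = ((~` A) `*` setT) `|` (setT `*` (~` B))).
  apply: analyticU; apply: analyticX; apply: measurable_analytic => //;
    exact: measurableC.
apply/seteqP; split=> -[x y] /=.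
  by have [Ax|] := pselect (A x); [move=> nAB; right; split=> // By; apply: nAB|left].
by move=> [[nAx _]|[_ nBy]] [].
Qed.

Lemma range_basic_ball_measurable : range basic_ball `<=` measurable.
Proof. by move=> _ [p _ <-]; exact: measurable_basic_ball. Qed.

(* On the set C below the centres of the balls p with [x \in B p] form a Cauchy
   family, whose limit is g x by completeness. *)
Lemma measurable_selection (B : nat * nat -> set T) :
  (forall p, measurable (B p)) ->
  exists2 g : T -> T, measurable_fun setT g &
    forall x y, (forall p, B p x <-> basic_ball p y) -> y = g x.
Proof.
move=> mB.
pose C := (\bigcap_n \bigcup_i B (i, n)) `&`
  \bigcap_p \bigcap_p' ((~` B p) `|` (~` B p') `|`
    [set _ | dist (q p.1) (q p'.1) < rad p.2 + rad p'.2]).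
have mC : measurable C.
  apply: measurableI.
    by apply: bigcapT_measurable => n; apply: bigcupT_measurable => i.
  apply: countable_bigcap_measurable => p; apply: countable_bigcap_measurable => p'.
  apply: measurableU; first by apply: measurableU; exact: measurableC.
  exact: measurable_const_prop.
(* Off [C] the value is the default [point], so preimages under [g] are trivially measurable
   there. *)
have /choice[g hg] : forall x, exists z, (C x -> forall p, B p x ->
    dist (q p.1) z <= rad p.2) /\ (~ C x -> z = point).
  move=> x; have [Cx|nCx] := pselect (C x); last by exists point.
  have /choice[i hi] : forall n, exists i, B (i, n) x.
    by move=> n; have [i _ ?] := Cx.1 n I; exists i.
  have near p p' : B p x -> B p' x ->
      dist (q p.1) (q p'.1) < rad p.2 + rad p'.2.
    by move=> Bp Bp'; have [[]|] := Cx.2 p I p' I.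
  have [|l hl] := @dist_complete pd (fun n => q (i n)).
    by move=> n m; apply: (near (i n, n) (i m, m)).
  exists l; split=> // _ p Bp; apply/ler_addgt0Pr => e e0.
  have [n hn] := rad_lt (divr_gt0 e0 (ltr0n _ 2)).
  have := dist_triangle pd (q (i n)) (q p.1) l; have := hl n.
  by have /= := near _ _ Bp (hi n); lra.
exists g; last first.
  move=> x y xy; have Cx : C x.
    split.
      move=> n _; have [i hi] := dist_dense pd y (rad_gt0 n).
      by exists i => //; apply/xy.
    move=> p _ p' _; have [/xy py|] := pselect (B p x); last by left; left.
    have [/xy p'y|] := pselect (B p' x); last by left; right.
    right => /=; have := dist_triangle pd y (q p.1) (q p'.1).
    by rewrite (distC pd y); move: py p'y; rewrite /basic_ball /=; lra.
  apply: contrapT => /dist_gt0 yg.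
  have [n hn] := rad_lt (divr_gt0 yg (ltr0n _ 2)).
  have [i hi] := dist_dense pd y (rad_gt0 n).
  have /(hg x).1 : B (i, n) x by apply/xy.
  move=> /(_ Cx) /=; have := dist_triangle pd (q i) y (g x).
  by rewrite (distC pd y (q i)); lra.
(* On [C], the value [g x] lies in the ball [p] exactly when some [p'] with [B p' x] has its closed
   ball inside [p]; this is a countable union of sets [B p']. *)
have gball p : measurable (g @^-1` (basic_ball p) `&` C).
  rewrite (_ : _ `&` _ = (\bigcup_(p' in [set p' : nat * nat |
      forall z, dist (q p'.1) z <= rad p'.2 -> basic_ball p z]) B p') `&` C).
    apply: measurableI => //; rewrite bigcup_mkcond.
    by apply: countable_bigcupT_measurable => // p'; case: ifP.
  apply/seteqP; split=> x [] => [gx Cx|[p' hp' Bx] Cx]; split=> //.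
    have e0 : 0 < rad p.2 - dist (q p.1) (g x) by rewrite subr_gt0.
    have [n hn] := rad_lt (divr_gt0 e0 (ltr0n _ 2)).
    have [i _ Bi] := Cx.1 n I.
    have := (hg x).1 Cx _ Bi => /= hi.
    exists (i, n) => //= z zi; rewrite /basic_ball /=.
    have := dist_triangle pd (g x) (q p.1) z.
    have := dist_triangle pd (q i) (g x) z.
    by rewrite (distC pd (g x) (q i)); lra.
  exact/hp'/((hg x).1).
move=> _ Y mY; rewrite setTI.
have -> : g @^-1` Y = (g @^-1` Y `&` C) `|` ([set _ | Y point] `&` ~` C).
  have gE x : ~ C x -> g x = point := (hg x).2.
  apply/seteqP; split=> x /=.
    by have [Cx|nCx] := pselect (C x); [left|rewrite (gE _ nCx); right].
  by move=> [[]//|[Yp /gE ->]].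
apply: measurableU; last first.
  apply: measurableI; last exact: measurableC.
  exact: measurable_const_prop.
have /smallest_sub : sigma_algebra setT
    [set Y : set T | measurable (g @^-1` Y `&` C)].
  split; first by rewrite /= preimage_set0 set0I.
    move=> A /= mA; rewrite (_ : _ `&` _ = C `\` (g @^-1` A `&` C)).
      exact: measurableD.
    by apply/seteqP; split=> x /= => [[[_ ?] ?]|[? h]]; split=> //;
      [case|split=> // ?; apply: h].
  move=> F mF /=; rewrite preimage_bigcup setI_bigcupl.
  exact: bigcupT_measurable.
apply; last exact: measurable_gen_basic_ball.
by move=> _ [p _ <-] /=.
Qed.

End polish.

(** * Borel sets with bounded sections *)

Definition small (T : eqType) (D : nat) (A : set T) :=
  exists s : seq T, (size s <= D)%N /\ forall y, A y -> y \in s.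

Section uniformization.
Context (R : realType) (d : measure_display) (T : measurableType d).
Context (dist : T -> T -> R) (q : nat -> T).
Hypothesis pd : polish_dist dist q.
Local Notation qball := (basic_ball dist q).
Local Notation analytic := (analytic (range qball)).

(** Two points are equal when at every radius some basic ball contains both. *)
Lemma measurable_diag : measurable [set z : T * T | z.1 = z.2].
Proof.
rewrite (_ : mkset _ = \bigcap_n \bigcup_i (qball (i, n) `*` qball (i, n))).
  apply: bigcapT_measurable => n; apply: bigcupT_measurable => i.
  by apply: measurableX; exact: measurable_basic_ball pd _.
apply/seteqP; split=> -[x y] /=.
  move=> -> n _; have [i hi] := dist_dense pd y (@rad_gt0 R n).
  by exists i.
move=> h; apply: contrapT => /(dist_gt0 pd) xy.
have [n hn] := rad_lt (divr_gt0 xy (ltr0n _ 2)).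
have [i _ []] := h n I; rewrite /basic_ball /= => ix iy.
have := dist_triangle pd (q i) x y.
by rewrite (distC pd x (q i)); lra.
Qed.

Lemma measurable_eq_fun (f g : T -> T) : measurable_fun setT f ->
  measurable_fun setT g -> measurable [set x | f x = g x].
Proof.
move=> mf mg; have mfg : measurable_fun setT (fun x => (f x, g x)).
  exact: measurable_fun_pair.
by have := mfg measurableT _ measurable_diag; rewrite setTI.
Qed.

Lemma measurable_graph (g : T -> T) : measurable_fun setT g ->
  measurable [set z : T * T | z.2 = g z.1].
Proof.
move=> mg; have m : measurable_fun setT (fun z : T * T => (z.2, g z.1)).
  by apply: measurable_fun_pair; [exact: measurable_snd|
    exact: measurableT_comp mg measurable_fst].
by have := m measurableT _ measurable_diag; rewrite setTI.
Qed.

Lemma analytic_section (E : set (T * T)) (V : set T) :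
  measurable E -> measurable V -> analytic (fst @` (E `&` (setT `*` V))).
Proof.
move=> mE mV; apply: (@analytic_fst _ _ _ (range qball)).
by apply: measurable_prod_analytic => //; apply: measurableI => //;
  exact: measurableX.
Qed.

(* Over W the events "the point of E x lies in p" and "lies outside p" are
   disjoint analytic sets; measurable separators pin that point down. *)
Lemma uniformization (E : set (T * T)) (W : set T) :
  measurable E -> analytic W ->
  (forall x y y', W x -> E (x, y) -> E (x, y') -> y = y') ->
  exists2 g : T -> T, measurable_fun setT g &
    forall x y, W x -> E (x, y) -> y = g x.
Proof.
move=> mE aW uE; have hT := basic_ball_hausdorff pd.
have /choice[B hB] p : separated_by_measurable
    (W `&` (fst @` (E `&` (setT `*` qball p))))
    (W `&` (fst @` (E `&` (setT `*` ~` qball p)))).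
  have mp : measurable (qball p) := measurable_basic_ball pd p.
  apply: (@lusin_separation _ _ (range qball)) => //.
  - exact: range_basic_ball_measurable pd.
  - by apply: analyticI => //; apply: analytic_section.
  - by apply: analyticI => //; apply: analytic_section => //; exact: measurableC.
  rewrite -subset0 => x [[Wx [[x1 y1] [E1 [_ /= py]] /= xx1]]].
  move=> [_ [[x2 y2] [E2 [_ /= npy]] /= xx2]]; apply: npy.
  by rewrite -(uE x y1 y2) // -?xx1 // xx1 -xx2.
have [g mg hg] := measurable_selection pd (fun p => let: And3 m _ _ := hB p in m).
exists g => // x y Wx Exy; apply: hg => p; have [_ sB dB] := hB p; split=> [Bx|py].
  apply: contrapT => npy; rewrite -[False]/(set0 x) -dB; split=> //.
  by split=> //; exists (x, y).
by apply: sB; split=> //; exists (x, y).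
Qed.

(** Cutting a point off a section lowers its size bound; this drives the induction on [D] below. *)
Lemma small_remove D (A B : set T) y :
  small D.+1 A -> A y -> ~ B y -> small D (A `&` B).
Proof.
move=> [s [sD As]] Ay nBy; exists (rem y s); split.
  by rewrite size_rem ?As // -ltnS prednK //; case: s sD As => // _ /(_ _ Ay).
move=> z [Az Bz]; apply: rem_mem; last exact: As.
by apply/eqP => zy; apply: nBy; rewrite -zy.
Qed.

(* A section with two points is cut by some ball p into two smaller sections,
   handled by induction over the analytic set of such x; removing the graphs
   obtained this way leaves sections with at most one point. *)
Theorem measurable_enumeration (D : nat) (E : set (T * T)) (W : set T) :
  measurable E -> analytic W -> (forall x, W x -> small D (xsection E x)) ->
  exists g : nat -> T -> T,
    (forall n, measurable_fun setT (g n)) /\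
    forall x y, W x -> E (x, y) -> exists n, y = g n x.
Proof.
have xE (F : set (T * T)) x y : xsection F x y <-> F (x, y).
  by rewrite xsectionE.
elim: D E W => [|D IHD] E W mE aW sE.
  exists (fun _ => id); split=> // x y /sE[s [+ sP]] /xE/sP.
  by rewrite leqn0 size_eq0 => /eqP ->.
have hT := basic_ball_hausdorff pd.
pose half c p := if c then qball p else ~` qball p : set T.
have mhalf c p : measurable (half c p).
  have mp : measurable (qball p) := measurable_basic_ball pd p.
  by case: c => //=; exact: measurableC.
pose Eh c p := E `&` (setT `*` half c p).
(* The [x] whose section has points both inside and outside the ball [p]. As this set involves
   projections it is only shown to be analytic, which is why the induction runs over analytic
   [W]. *)
pose Wh p := W `&` (fst @` Eh true p) `&` (fst @` Eh false p).
have aWh p : analytic (Wh p).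
  by do 2?[apply: analyticI => //]; exact: analytic_section.
have mEh c p : measurable (Eh c p).
  by apply: measurableI => //; exact: measurableX.
have sEh c p x : Wh p x -> small D (xsection (Eh c p) x).
  move=> [[Wx [[x1 y1] [E1 [_ /= p1]] /= xx1]] [[x2 y2] [E2 [_ /= p2]] /= xx2]].
  rewrite (_ : xsection _ _ = xsection E x `&` half c p); last first.
    by apply/seteqP; split=> y; rewrite /= !xE /Eh => -[] // ? []; split.
  rewrite -{}xx1 in Wx xx2 *; rewrite {}xx2 in E2.
  case: c.
    by apply: (@small_remove _ _ _ y2); [exact: sE|exact/xE|].
  by apply: (@small_remove _ _ _ y1); [exact: sE|exact/xE|apply].
have /choice[g hg] (cp : bool * (nat * nat)) : exists g : nat -> T -> T,
    (forall n, measurable_fun setT (g n)) /\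
    forall x y, Wh cp.2 x -> Eh cp.1 cp.2 (x, y) -> exists n, y = g n x.
  by apply: IHD => // x; apply: sEh.
pose E' := E `\` \bigcup_(i : bool * (nat * nat) * nat)
  [set z | z.2 = g i.1 i.2 z.1].
have [|||ginf mginf hginf] := @uniformization E' W.
- apply: measurableD => //; apply: countable_bigcupT_measurable => // i.
  exact: measurable_graph ((hg i.1).1 i.2).
- by [].
(* If two points of the section remained, a ball around [y] avoiding [y'] would put [x] in [Wh p],
   so [y] would already have been enumerated. *)
- move=> x y y' Wx [Exy nxy] [Exy' nxy']; apply: contrapT => /(dist_gt0 pd) yy'.
  have [p [yp hp]] := basic_ball_nbhs pd y yy'.
  have Wpx : Wh p x.
    split; [split=> //|]; [exists (x, y)|exists (x, y')] => //; split=> //.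
    by split=> //= /hp; rewrite ltxx.
  have [|n yn] := (hg (true, p)).2 x y Wpx; first by split.
  by apply: nxy; exists (true, p, n).
exists (fun m => if unpickle m is Some (Some i) then g i.1 i.2 else ginf).
split=> [m|x y Wx Exy].
  by case: unpickle => [[i|]|] //; exact: (hg i.1).1 i.2.
have [[[cp n] _ yn]|nyn] := pselect ((\bigcup_(i : bool * (nat * nat) * nat)
    [set z | z.2 = g i.1 i.2 z.1]) (x, y)).
  by exists (pickle (Some (cp, n))); rewrite pickleK.
exists (pickle (@None (bool * (nat * nat) * nat))); rewrite pickleK.
by apply: hginf => //; split.
Qed.
End uniformization.

(** * A Polish distance on a standard Borel space *)

Section standard_borel_polish.
Context (R : realType) (d : measure_display) (T : measurableType d).

(** The metric of [M] is pulled back along the Borel isomorphism. By density, every open set is a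
    countable union of the basic balls it contains, so these balls generate. *)
Lemma standard_borel_polish_dist : standard_borel R T ->
  exists (dist : T -> T -> R) (q : nat -> T), polish_dist dist q.
Proof.
move=> [M [f [cM [S cS dS] bf mf]]].
have [g gK fK] := bf.
have openball (x : M) e : open (ball x e).
  rewrite ballEmdist openE => y /= xy; apply/nbhs_ballP.
  exists (e - mdist x y); first by rewrite /= subr_gt0.
  rewrite ballEmdist => z /= yz.
  by have := metric_triangle x y z; lra.
have [h hinj] := elimT (countable_injP _) cS.
have [s0 Ss0] : S !=set0.
  have [||z []] := dS setT; [by exists (f point)|exact: openT|by exists z].
(* This inverts the injection [h] of the countable dense set, with default [s0] at indices that [h]
   misses. *)
pose q n := g (xget s0 [set s | S s /\ h s = n]).
have qS s : S s -> exists n, q n = g s.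
  move=> Ss; exists (h s); rewrite /q; congr g; case: xgetP => [y _ [Sy hy]|].
    by apply: hinj => //; exact: mem_set.
  by move=> /(_ s)[].
pose qb := basic_ball (fun x y => mdist (f x) (f y)) q.
exists (fun x y => mdist (f x) (f y)), q; split.
- by move=> x; exact: mdistxx.
- by move=> x y /mdist_positivity/(can_inj gK).
- by move=> x y; exact: metric_sym.
- by move=> y x z; exact: metric_triangle.
- move=> x e e0; have [||z [xz Sz]] := dS (ball (f x) e);
    [by exists (f x); exact: ballxx|exact: openball|].
  have [n hn] := qS z Sz; exists n; rewrite hn fK metric_sym.
  by move: xz; rewrite ballEmdist.
- move=> u hu; have [|l hl] := cM (f (u n) @[n --> \oo]) _.
    apply/cauchyP => e e0; have [n hn] := rad_lt (divr_gt0 e0 (ltr0n _ 2)).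
    exists (f (u n)); rewrite ballEmdist /=; exists n => // m /= nm /=.
    have := hu n m; have : rad R m <= rad R n.
      by rewrite /rad lef_pV2 ?posrE ?ltr0n // ler_nat.
    lra.
  exists (g l) => n; rewrite fK; apply/ler_addgt0Pr => e e0.
  have [n1 hn] := rad_lt (divr_gt0 e0 (ltr0n _ 2)).
  have /cvg_ballP/(_ _ (divr_gt0 e0 (ltr0n _ 2)))[n2 _ hn2] := hl.
  have := hn2 (maxn n1 n2) (leq_maxr _ _); rewrite ballEmdist /= => ul.
  have := hu n (maxn n1 n2).
  have : rad R (maxn n1 n2) <= rad R n1.
    by rewrite /rad lef_pV2 ?posrE ?ltr0n // ler_nat ltnS leq_maxl.
  have := metric_triangle (f (u n)) (f (u (maxn n1 n2))) l.
  rewrite (metric_sym (f (u (maxn n1 n2))) l); lra.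
- move=> p; rewrite (_ : basic_ball _ _ _ = f @^-1` (ball (f (q p.1)) (rad R p.2))).
    by apply: (mf (ball (f (q p.1)) (rad R p.2))).1; apply: sub_sigma_algebra; exact: openball.
  by rewrite ballEmdist.
- move=> A mA; set Q := range _.
  have fgA : f @^-1` (g @^-1` A) = A by apply/seteqP; split=> x /=; rewrite gK.
  rewrite -fgA in mA *; move: (g @^-1` A) mA => B {fgA} /(mf B).2 mB.
  have /smallest_sub : sigma_algebra setT [set U : set M | <<s Q >> (f @^-1` U)].
    split; rewrite /=; first by rewrite preimage_set0; exact: sigma_algebra0.
      by move=> U hU; rewrite setTD preimage_setC; exact: sigma_algebraC.
    by move=> U hU; rewrite preimage_bigcup; exact: sigma_algebra_bigcup.
  apply; last exact: mB.
  move=> U /= oU.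
  pose F n := if unpickle n is Some p then
    if `[< qb p `<=` f @^-1` U >] then qb p else set0 else set0.
  rewrite (_ : f @^-1` U = \bigcup_n F n).
    apply: sigma_algebra_bigcup => n; rewrite /F.
    case: unpickle => [p|]; last exact: sigma_algebra0.
    case: ifP => _; last exact: sigma_algebra0.
    by apply: sub_sigma_algebra; exists p.
  apply/seteqP; split=> x; last first.
    move=> [n _]; rewrite /F; case: unpickle => // p.
    by case: asboolP => // pU /pU.
  move=> Ux; have /nbhs_ballP[e /= e0 xU] : nbhs (f x) U by exact: open_nbhs_nbhs.
  have [n hn] := rad_lt (divr_gt0 e0 (ltr0n _ 2)).
  have [||z [xz Sz]] := dS (ball (f x) (rad R n));
    [by exists (f x); apply: ballxx; exact: rad_gt0|exact: openball|].
  have [i hi] := qS z Sz; exists (pickle (i, n)) => //.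
  have zx : mdist z (f x) < rad R n by rewrite metric_sym; move: xz; rewrite ballEmdist.
  rewrite /F pickleK; case: asboolP => [_|[]]; rewrite /qb /basic_ball /= hi fK //.
  move=> y /= zy; apply: xU; rewrite ballEmdist /=.
  have := metric_triangle (f x) z (f y); rewrite (metric_sym (f x) z); lra.
Qed.
End standard_borel_polish.

(** * Balls and their isomorphism types *)

Section cardinals.
Context {T : choiceType}.

Lemma small_finite n (A : set T) : small n A -> finite_set A.
Proof.
move=> [s [_ As]]; apply: (@sub_finite_set _ _ [set` s]).
  by move=> y /As.
exact: finite_seq.
Qed.

Lemma card_uniq_seq (A : set T) (s : seq T) : uniq s ->
  (forall y, A y <-> y \in s) -> finite_set A /\ #|` fset_set A| = size s.
Proof.
move=> us As; have fA : finite_set A.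
  by apply: (@small_finite (size s)); exists s; split=> // y /As.
split=> //; apply: perm_size; apply: uniq_perm => //.
by move=> y; rewrite in_fset_set //; apply/idP/idP => [/set_mem/As|/As/mem_set].
Qed.

Lemma finite_uniq_seq (A : set T) : finite_set A ->
  exists2 s : seq T, uniq s & forall y, A y <-> y \in s.
Proof.
move=> /finite_seqP[s ->]; exists (undup s); first exact: undup_uniq.
by move=> y; rewrite mem_undup.
Qed.

Lemma small_card n (A : set T) : small n A -> (#|` fset_set A| <= n)%N.
Proof.
move=> sA; have [s us As] := finite_uniq_seq (small_finite sA).
have [_ ->] := card_uniq_seq us As; have [t [tn At]] := sA.
by apply: leq_trans tn; apply: uniq_leq_size => // y /As/At.
Qed.

Lemma small_bigcup n m (A : set T) (F : T -> set T) :
  small n A -> (forall y, small m (F y)) -> small (n * m) (\bigcup_(y in A) F y).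
Proof.
move=> [s [sn As]] /choice[t ht].
exists (flatten [seq t y | y <- s]); split; last first.
  move=> z [y Ay Fz]; apply/flattenP; exists (t y); last exact: (ht y).2.
  by apply: map_f; exact: As.
apply: leq_trans (leq_mul sn (leqnn m)).
elim: s {sn As} => //= y s IHs; rewrite size_cat mulSn leq_add //.
exact: (ht y).1.
Qed.

Lemma card_proper (A B : set T) : finite_set B -> A `<=` B -> ~ B `<=` A ->
  (#|` fset_set A| < #|` fset_set B|)%N.
Proof.
move=> fB AB nBA; have fA := sub_finite_set AB fB.
apply: fproper_ltn_card; rewrite fproperE; apply/andP; split.
  by apply/fsubsetP => x; rewrite !in_fset_set // => /set_mem/AB/mem_set.
apply/fsubsetP => BA; apply: nBA => x Bx.
by have := BA x; rewrite !in_fset_set // => /(_ (mem_set Bx))/set_mem.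
Qed.

Lemma card_le (A B : set T) : finite_set B -> A `<=` B ->
  (#|` fset_set A| <= #|` fset_set B|)%N.
Proof.
move=> fB AB; have fA := sub_finite_set AB fB; apply: fsubset_leq_card.
by apply/fsubsetP => x; rewrite !in_fset_set // => /set_mem/AB/mem_set.
Qed.

End cardinals.

Section balls.
Context {T : choiceType} (e : rel T).

Definition ball_order (r : nat) (x : T) := #|` fset_set (graph_ball e r x)|.

Lemma graph_ball0 x : graph_ball e 0 x = [set x].
Proof.
apply/seteqP; split=> y; first by move=> [[|z p] [] //= _ ->].
by move=> ->; exists [::].
Qed.

Lemma graph_ballS r x : graph_ball e r.+1 x =
  \bigcup_(y in graph_ball e r x) ([set y] `|` [set z | e y z]).
Proof.
apply/seteqP; split=> y.
  move=> [p []]; case/lastP: p => [|p z].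
    by move=> _ /= <- _; exists x; [exists [::]|left].
  rewrite rcons_path last_rcons size_rcons => /andP[pp ez] zy sp.
  exists (last x p); first by exists p.
  by right; rewrite -zy.
move=> [z [p [pp zE sp]] [->|/= ezy]]; first by exists p; split=> //; exact: leqW.
exists (rcons p y); rewrite rcons_path last_rcons size_rcons ltnS zE.
by split=> //; apply/andP.
Qed.

Lemma graph_ball_leS r x : graph_ball e r x `<=` graph_ball e r.+1 x.
Proof. by rewrite graph_ballS => y xy; exists y => //; left. Qed.

Lemma graph_ball_component r x : graph_ball e r x `<=` component e x.
Proof. by move=> y [p [pp pE _]]; exists p. Qed.

Lemma graph_ball_center r x : graph_ball e r x x.
Proof. by exists [::]. Qed.

Lemma component_closed (A : set T) x : A x ->
  (forall y z, A y -> e y z -> A z) -> component e x `<=` A.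
Proof.
move=> Ax cA y [p [pp <-]] {y}.
elim: p x Ax pp => //= y p IHp x Ax /andP[exy pp].
by apply: IHp => //; apply: cA exy.
Qed.

Variable D : nat.
Hypothesis degD : forall x, small D [set y | e x y].

Lemma small_graph_ball r x : small (D.+1 ^ r) (graph_ball e r x).
Proof.
elim: r => [|r IHr].
  by rewrite graph_ball0; exists [:: x]; split=> // y ->; rewrite mem_head.
rewrite graph_ballS expnSr; apply: small_bigcup => // y.
have [s [sD sP]] := degD y; exists (y :: s); split=> //.
by move=> z [->|/sP]; rewrite inE ?eqxx // => ->; rewrite orbT.
Qed.

Lemma finite_graph_ball r x : finite_set (graph_ball e r x).
Proof. exact: small_finite (small_graph_ball r x). Qed.

Lemma ball_order_bound r x : (ball_order r x <= D.+1 ^ r)%N.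
Proof. exact/small_card/small_graph_ball. Qed.

Lemma ball_order_gt0 r x : (0 < ball_order r x)%N.
Proof.
rewrite cardfs_gt0; apply/fset0Pn; exists x.
rewrite in_fset_set; last exact: finite_graph_ball.
by apply: mem_set; exact: graph_ball_center.
Qed.

(** Each enlargement of the radius either adds a node or adds nothing; in the latter case the ball
    is closed under adjacency and is the whole component. *)
Lemma component_eq_ball_or_large r x :
  component e x = graph_ball e r x \/ (r < ball_order r x)%N.
Proof.
elim: r => [|r [IHr|IHr]]; first by right; exact: ball_order_gt0.
  left; apply/seteqP; split; last exact: graph_ball_component.
  by rewrite IHr; exact: graph_ball_leS.
have [sub|nsub] := pselect (graph_ball e r.+1 x `<=` graph_ball e r x).
  left; apply/seteqP; split; last exact: graph_ball_component.
  apply: subset_trans (@graph_ball_leS r x).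
  apply: component_closed; first exact: graph_ball_center.
  move=> y z xy yz; apply: sub; rewrite graph_ballS; exists y => //; by right.
right; apply: leq_ltn_trans IHr _; apply: card_proper => //.
  exact: finite_graph_ball.
exact: graph_ball_leS.
Qed.

(** If the ball is not the component it has at least [r.+1] nodes, and both reciprocals lie between
    0 and [rad R r]; an infinite component gives [c = 0]. *)
Lemma component_order_approx (R : realType) r x : exists c : R,
  [/\ (counting (component e x))^-1%E = c%:E, 0 <= c,
      c <= (ball_order r x)%:R^-1 & (ball_order r x)%:R^-1 <= c + rad R r].
Proof.
have inveN n : (0 < n)%N -> (n%:R%:E)^-1%E = (n%:R^-1)%:E :> \bar R.
  by case: n => // n _; rewrite inver pnatr_eq0.
have small_inv : (r < ball_order r x)%N -> (ball_order r x)%:R^-1 <= rad R r.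
  by move=> h; rewrite /rad lef_pV2 ?posrE ?ltr0n ?ball_order_gt0 // ler_nat.
have bx0 := ball_order_gt0 r x.
have fb := finite_graph_ball r x.
rewrite /counting; have [cE|large] := component_eq_ball_or_large r x.
  exists (ball_order r x)%:R^-1; rewrite cE; case: asboolP => // _.
  by rewrite inveN //; split=> //; rewrite ?invr_ge0 ?ler0n // lerDl ltW ?rad_gt0.
case: asboolP => fc; last first.
  by exists 0; rewrite invey add0r invr_ge0 ler0n small_inv.
have le_bc : (ball_order r x <= #|` fset_set (component e x)|)%N.
  by apply: card_le => //; exact: graph_ball_component.
exists (#|` fset_set (component e x)|%:R^-1); rewrite inveN; last exact: leq_trans le_bc.
split=> //; rewrite ?invr_ge0 ?ler0n //.
  by rewrite lef_pV2 ?posrE ?ltr0n ?ler_nat //; exact: leq_trans le_bc.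
by apply: le_trans (small_inv large) _; rewrite lerDr invr_ge0 ler0n.
Qed.

End balls.

(** * Rooted isomorphism and finite lists of ball types *)

Definition rg_iso (H K : rooted_graph) :=
  exists f : 'I_(rg_order H) -> 'I_(rg_order K),
    [/\ bijective f, f (rg_root H) = rg_root K &
        forall i j, rg_adj (f i) (f j) = rg_adj i j].

Lemma rg_iso_refl H : rg_iso H H.
Proof. by exists id; split=> //; exists id. Qed.

Lemma rg_iso_sym H K : rg_iso H K -> rg_iso K H.
Proof.
move=> [f [[g fK gK] fr fa]]; exists g; split; first by exists f.
  by rewrite -fr fK.
by move=> i j; rewrite -fa !gK.
Qed.

Lemma rg_iso_trans H K L : rg_iso H K -> rg_iso K L -> rg_iso H L.
Proof.
move=> [f [bf fr fa]] [g [bg gr ga]]; exists (g \o f); split.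
- exact: bij_comp.
- by rewrite /= fr.
- by move=> i j; rewrite /= ga fa.
Qed.

Section ball_types.
Context {T : choiceType} (e : rel T) (r : nat) (x : T).

Lemma ball_type_order H : ball_type e r x H -> ball_order e r x = rg_order H.
Proof.
move=> [phi [iphi _ rphi _]]; rewrite /ball_order -rphi.
have [||_ ->] := @card_uniq_seq _ (range phi) [seq phi i | i <- enum 'I_(rg_order H)].
- by rewrite map_inj_uniq // enum_uniq.
- move=> y; split=> [[i _ <-]|/mapP[i _ ->]]; last by exists i.
  by apply: map_f; rewrite mem_enum.
- by rewrite size_map size_enum_ord.
Qed.

(** A type is thus a single isomorphism class, so one representative determines it. *)
Lemma ball_type_iso H K : ball_type e r x H -> ball_type e r x K <-> rg_iso H K.
Proof.
move=> [phi [iphi phir rphi aphi]]; split=> [[psi [ipsi psir rpsi apsi]]|].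
  have /choice[f fE] i : exists j, psi j = phi i.
    have : range psi (phi i) by rewrite rpsi -rphi; exists i.
    by move=> [j _ ji]; exists j.
  have /choice[g gE] j : exists i, phi i = psi j.
    have : range phi (psi j) by rewrite rphi -rpsi; exists j.
    by move=> [i _ ij]; exists i.
  exists f; split.
  - exists g => [i|j]; first by apply: iphi; rewrite gE fE.
    by apply: ipsi; rewrite fE gE.
  - by apply: ipsi; rewrite fE phir psir.
  - by move=> i j; rewrite apsi aphi !fE.
move=> /rg_iso_sym[f [[g fK gK] fr fa]]; exists (phi \o f); split.
- exact: inj_comp iphi (can_inj fK).
- by rewrite /= fr.
- rewrite -rphi; apply/seteqP; split=> y [i _ <-]; first by exists (f i).
  by exists (g i) => //=; rewrite gK.
- by move=> i j /=; rewrite -fa aphi.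
Qed.

Lemma ball_type_exists : symmetric e -> irreflexive e ->
  finite_set (graph_ball e r x) -> exists H, ball_type e r x H.
Proof.
move=> se ie /finite_uniq_seq[s us sE].
have xs : (index x s < size s)%N.
  by rewrite index_mem; apply/sE/graph_ball_center.
pose adj (i j : 'I_(size s)) := e (nth x s i) (nth x s j).
have sadj : symmetric adj by move=> i j; exact: se.
have iadj : irreflexive adj by move=> i; exact: ie.
exists (RootedGraph sadj iadj (Ordinal xs)), (fun i => nth x s i); split=> //.
- by move=> i j /eqP; rewrite nth_uniq // => /eqP/val_inj.
- by rewrite /= nth_index // -index_mem.
- apply/seteqP; split=> y; first by move=> [i _ <-]; apply/sE; rewrite mem_nth.
  move=> /sE ys; have iy : (index y s < size s)%N by rewrite index_mem.
  by exists (Ordinal iy) => //=; rewrite nth_index.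
Qed.

End ball_types.

(** An order, an adjacency table and a root: a finite type whose codes reach every rooted graph of
    order at most [N] up to isomorphism. *)
Definition rg_code (N : nat) :=
  {n : 'I_N.+1 & {ffun 'I_n * 'I_n -> bool} * 'I_n}%type.

HB.instance Definition _ N := Finite.on (rg_code N).

(* Symmetrizing arbitrary boolean tables lets every code denote a graph. *)
Definition code_adj n (a : {ffun 'I_n * 'I_n -> bool}) : rel 'I_n :=
  fun i j => (i != j) && (a (i, j) || a (j, i)).

Lemma code_adj_sym n (a : {ffun 'I_n * 'I_n -> bool}) : symmetric (code_adj a).
Proof. by move=> i j; rewrite /code_adj eq_sym orbC. Qed.

Lemma code_adj_irr n (a : {ffun 'I_n * 'I_n -> bool}) : irreflexive (code_adj a).
Proof. by move=> i; rewrite /code_adj eqxx. Qed.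

Definition rg_decode N (c : rg_code N) : rooted_graph :=
  RootedGraph (code_adj_sym (tagged c).1) (code_adj_irr (tagged c).1) (tagged c).2.

Lemma rg_decode_surj N H : (rg_order H <= N)%N ->
  exists c : rg_code N, rg_iso H (rg_decode c).
Proof.
move=> HN; have HN' : (rg_order H < N.+1)%N by [].
pose a := [ffun p : 'I_(rg_order H) * 'I_(rg_order H) => rg_adj p.1 p.2].
exists (@Tagged _ (Ordinal HN') (fun n : 'I_N.+1 =>
  ({ffun 'I_n * 'I_n -> bool} * 'I_n)%type) (a, rg_root H)).
exists id; split=> //; first by exists id.
move=> i j /=; rewrite /code_adj !ffunE /= (rg_adj_sym j i) orbb.
by case: eqVneq => // ->; rewrite rg_adj_irr.
Qed.

Lemma rg_representatives N : exists (I : finType) (rep : I -> rooted_graph),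
  (forall H, (rg_order H <= N)%N -> exists i, rg_iso H (rep i)) /\
  (forall i j, rg_iso (rep i) (rep j) -> i = j).
Proof.
(* The code picked depends only on the isomorphism class, so the fixed points of [canon] consist of
   one code per class. *)
pose canon (c : rg_code N) := [pick c' : rg_code N | `[< rg_iso (rg_decode c) (rg_decode c') >]].
have canonE (c c' : rg_code N) : rg_iso (rg_decode c) (rg_decode c') -> canon c = canon c'.
  move=> cc'; apply: eq_pick => c'' /=; apply/asboolP/asboolP; apply: rg_iso_trans => //.
  exact: rg_iso_sym.
exists {c : rg_code N | canon c == Some c}, (fun c => rg_decode (val c)); split.
  move=> H /rg_decode_surj[c Hc].
  have : canon c != None.
    by rewrite /canon; case: pickP => // /(_ c)/asboolP[]; exact: rg_iso_refl.
  case cc' : (canon c) => [c'|//] _; have iso : rg_iso (rg_decode c) (rg_decode c').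
    by move: cc'; rewrite /canon; case: pickP => // ? /asboolP + [<-].
  have c'c' : canon c' == Some c' by rewrite -(canonE _ _ iso) cc'.
  by exists (exist _ c' c'c'); exact: rg_iso_trans iso.
move=> [c cc] [c' cc'] /canonE; rewrite (eqP cc) (eqP cc') => -[cc'E].
exact: val_inj.
Qed.

(** Uniqueness of [i] ensures that a sum over [I] counts each ball exactly once. *)
Definition represents_balls (I : Type) (rep : I -> rooted_graph)
    (T : eqType) (e : rel T) (r : nat) :=
  forall x, exists2 i, ball_type e r x (rep i) &
    forall j, ball_type e r x (rep j) -> j = i.

(** The indices are fixed before the graph, so that one finite family serves a graphing and all
    graphs of a sequence converging to it. *)
Lemma ball_type_indices N : exists (I : finType) (rep : I -> rooted_graph),
  forall (T : choiceType) (e : rel T), symmetric e -> irreflexive e ->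
  forall r, (forall x, finite_set (graph_ball e r x)) ->
  (forall x, (ball_order e r x <= N)%N) ->
  represents_balls rep e r.
Proof.
have [I [rep [repE rep_inj]]] := rg_representatives N.
exists I, rep => T e se ie r fb bN x.
have [H HP] := ball_type_exists se ie (fb x).
have [|i Hi] := repE H; first by rewrite -(ball_type_order HP).
have xi : ball_type e r x (rep i) by apply/(ball_type_iso _ HP).
exists i => // j /(ball_type_iso _ xi) ij.
exact/esym/rep_inj.
Qed.

(** * Graphings *)

Section ball_type_measurability.
Context (R : realType) (d : measure_display) (T : measurableType d).
Context (dist : T -> T -> R) (q : nat -> T).
Hypothesis pd : polish_dist dist q.
Context (E : set (T * T)) (D : nat).
Hypothesis mE : measurable E.
Hypothesis degE : forall x, small D (xsection E x).
Local Notation e := (fun x y : T => (x, y) \in E).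

Lemma measurable_edge (f g : T -> T) : measurable_fun setT f ->
  measurable_fun setT g -> measurable [set x | E (f x, g x)].
Proof.
move=> mf mg; have mfg : measurable_fun setT (fun x => (f x, g x)).
  exact: measurable_fun_pair.
by have := mfg measurableT _ mE; rewrite setTI.
Qed.

(* The steps are made total by staying put when there is no edge to follow. *)
Lemma measurable_steps : exists h : nat -> T -> T,
  [/\ forall n, measurable_fun setT (h n),
      forall n x, h n x = x \/ E (x, h n x) &
      forall x y, E (x, y) -> exists n, y = h n x].
Proof.
have [g [mg gE]] := measurable_enumeration pd mE (analyticT pd) (fun x _ => degE x).
have mS n : measurable [set x | E (x, g n x)].
  by apply: measurable_edge => //; exact: measurable_id.
exists (fun n x => if e x (g n x) then g n x else x); split.
- move=> n _ Y mY; rewrite setTI.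
  rewrite (_ : _ @^-1` Y = (g n @^-1` Y `&` [set x | E (x, g n x)]) `|`
      (Y `&` ~` [set x | E (x, g n x)])).
    apply: measurableU; apply: measurableI => //; last exact: measurableC.
    by rewrite -[_ @^-1` _]setTI; exact: mg.
  apply/seteqP; split=> x /=; case: ifPn => [/set_mem xE|/negP xE].
  + by left.
  + by move=> Yx; right; split=> // /mem_set.
  + by move=> [[]|[]].
  + by move=> [[_ /mem_set]|[]].
- move=> n x; case: ifPn => [/set_mem|_]; [by right|by left].
- move=> x y xy; have [n yn] := gE x y I xy; exists n.
  by rewrite -yn (mem_set xy).
Qed.

(** The nodes of the ball are the images of [x] under words of at most [r] measurable steps. An
    isomorphism from [H] is therefore given by a choice [a] of words, one per node of [H]. There are
    countably many choices, and each requirement on [a] is a countable combination of equalities and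
    edges between measurable functions of [x]. *)
Lemma measurable_ball_type r H : measurable [set x | ball_type e r x H].
Proof.
have [h [mh hE Eh]] := measurable_steps.
pose act (w : seq nat) x := foldl (fun y n => h n y) x w.
have mact w : measurable_fun setT (act w).
  elim/last_ind: w => [|w n IHw]; first exact: measurable_id.
  rewrite /act; under eq_fun do rewrite foldl_rcons.
  by apply: measurableT_comp; [exact: mh|exact: IHw].
have ball_act x y : graph_ball e r x y <-> exists2 w, (size w <= r)%N & act w x = y.
  split=> [[p [pp <-]] {y}|[w + <-] {y}].
    elim: p r x pp => [|y p IHp] [|s] x //=; try by exists [::].
    move=> /andP[/set_mem/Eh[n yn] pp]; rewrite ltnS => /(IHp s y pp)[w ws wE].
    by exists (n :: w) => //=; rewrite -yn.
  elim: w r x => [|n w IHw] [|s] x //=; try by move=> _; exists [::].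
  rewrite ltnS => /(IHw s (h n x))[p [pp pE ps]].
  (* A letter that stays put contributes no edge, so the path may be shorter than the word. *)
  have [hx|xh] := hE n x.
    by rewrite /= hx in pp pE *; exists p; split=> //; apply: leqW.
  by exists (h n x :: p); split=> //=; apply/andP; split=> //; exact: mem_set.
pose n := rg_order H.
rewrite (_ : mkset _ = \bigcup_(a : {ffun 'I_n -> seq nat})
  ([set x | forall i j, i != j -> act (a i) x <> act (a j) x] `&`
   [set x | act (a (rg_root H)) x = x] `&`
   [set _ | forall i, (size (a i) <= r)%N] `&`
   [set x | forall w, (size w <= r)%N -> exists i, act (a i) x = act w x] `&`
   [set x | forall i j, rg_adj i j <-> E (act (a i) x, act (a j) x)])).
  apply: countable_bigcupT_measurable; first exact: countableP.
  move=> a.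
  do 4?apply: measurableI.
  - apply: measurable_forall => i; apply: measurable_forall => j; apply: measurable_imply.
    by apply: measurableC; apply: measurable_eq_fun pd _ _ _ _.
  - by apply: measurable_eq_fun pd _ _ _ _ => //; exact: measurable_id.
  - exact: measurable_const_prop.
  - apply: measurable_forall => w; apply: measurable_imply; apply: measurable_exists => i.
    exact: measurable_eq_fun pd _ _ _ _.
  - apply: measurable_forall => i; apply: measurable_forall => j; case: (rg_adj i j).
      rewrite (_ : mkset _ = [set x | E (act (a i) x, act (a j) x)]).
        exact: measurable_edge.
      by apply/seteqP; split=> x /=; [case=> + _; exact|].
    rewrite (_ : mkset _ = ~` [set x | E (act (a i) x, act (a j) x)]).
      by apply: measurableC; exact: measurable_edge.
    by apply/seteqP; split=> x /=; [case=> _ + /[dup] => /[apply]|split].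
apply/seteqP; split=> x.
  move=> [phi [iphi phir rphi aphi]].
  have /choice[a ha] i : exists w, (size w <= r)%N /\ act w x = phi i.
    have : graph_ball e r x (phi i) by rewrite -rphi; exists i.
    by move=> /ball_act[w ? ?]; exists w.
  exists (finfun a) => //; split; [split; [split; [split|]|]|] => /=.
  - move=> i j /eqP ij; rewrite !ffunE (ha i).2 (ha j).2 => /iphi; exact: ij.
  - by rewrite ffunE (ha _).2.
  - by move=> i; rewrite ffunE (ha i).1.
  - move=> w wr; have : graph_ball e r x (act w x) by apply/ball_act; exists w.
    by rewrite -rphi => -[i _ <-]; exists i; rewrite ffunE (ha i).2.
  - move=> i j; rewrite !ffunE (ha i).2 (ha j).2 aphi.
    by split=> [/set_mem|/mem_set].
move=> [a _ [[[[inj rt] ar] surj] adj]].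
exists (fun i => act (a i) x); split => //.
- move=> i j; case: (eqVneq i j) => // /inj + /[dup] => /[apply] //.
- apply/seteqP; split=> y; first by move=> [i _ <-]; apply/ball_act; exists (a i).
  by move=> /ball_act[w /surj[i <-] <-]; exists i.
- by move=> i j; apply/idP/idP => [/adj/mem_set|/set_mem/adj].
Qed.

End ball_type_measurability.

(** Only one indicator is nonzero at [x]. Averages of the reciprocal order thereby become functions
    of the ball distribution. *)
Lemma ball_order_inv_sum (R : realType) (I : finType) (rep : I -> rooted_graph)
    (T : choiceType) (e : rel T) r : represents_balls rep e r -> forall x,
  (ball_order e r x)%:R^-1 = \sum_i (rg_order (rep i))%:R^-1 *
    (`[< ball_type e r x (rep i) >])%:R :> R.
Proof.
move=> hrep x; have [i xi uni] := hrep x; rewrite (bigD1 i) //= big1.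
  by rewrite addr0 asboolT // mulr1 (ball_type_order xi).
move=> j ji; case: asboolP => [/uni ij|]; last by rewrite mulr0.
by rewrite ij eqxx in ji.
Qed.

Section graphings.
Context (R : realType) (G : graphing R) (D : nat).
Hypothesis degD : gr_deg_le G D.
Local Notation E := (@gr_edge R G).
Local Notation P := (@gr_prob R G).
Local Notation e := (@gr_adj R G).

Lemma gr_small_section x : small D (xsection E x).
Proof.
have := degD x; rewrite /set_deg setIT /counting; case: asboolP => // fE.
rewrite lee_fin ler_nat => cE; have [s us sE] := finite_uniq_seq fE.
have [_ sz] := card_uniq_seq us sE; exists s; split; first by rewrite -sz.
by move=> y /sE.
Qed.

Lemma gr_small_adj x : small D [set y | e x y].
Proof.
exact: gr_small_section.
Qed.

Lemma gr_adj_sym : symmetric e.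
Proof. by move=> x y; apply/idP/idP => /set_mem/gr_edge_sym/mem_set. Qed.

Lemma gr_adj_irr : irreflexive e.
Proof. by move=> x; apply/negP => /set_mem/gr_edge_irr. Qed.

Lemma measurable_gr_ball_type r H : measurable [set x | ball_type e r x H].
Proof.
have [dist [q pd]] := standard_borel_polish_dist (gr_standard G).
apply: (measurable_ball_type pd) gr_small_section _ _.
exact: gr_edge_measurable.
Qed.

Lemma gr_component_fine r x :
  let c := fine (counting (component e x))^-1%E : R in
  [/\ (counting (component e x))^-1%E = c%:E, 0 <= c,
      c <= (ball_order e r x)%:R^-1 & (ball_order e r x)%:R^-1 <= c + rad R r].
Proof.
by have [c [cE c0 cl cr]] := component_order_approx gr_small_adj R r x; rewrite cE.
Qed.

Section representatives.
Context (I : finType) (rep : I -> rooted_graph) (r : nat).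
Hypothesis hrep : represents_balls rep e r.

Lemma ball_order_inv_indic x : (ball_order e r x)%:R^-1 =
  \sum_i (rg_order (rep i))%:R^-1 * \1_[set x | ball_type e r x (rep i)] x :> R.
Proof.
rewrite (ball_order_inv_sum R hrep); apply: eq_bigr => i _.
by rewrite indicE /in_mem /= /in_set.
Qed.

Lemma measurable_ball_order_inv :
  measurable_fun setT (fun x => (ball_order e r x)%:R^-1 : R).
Proof.
under eq_fun do rewrite ball_order_inv_indic.
apply: measurable_sum => i; apply: measurable_funM => //.
by apply: measurable_indic; exact: measurable_gr_ball_type.
Qed.

Lemma integral_ball_order_inv :
  (\int[P]_x ((ball_order e r x)%:R^-1)%:E =
   (\sum_i (rg_order (rep i))%:R^-1 * gr_ball_prob G r (rep i))%:E)%E.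
Proof.
under eq_integral do rewrite ball_order_inv_indic -sumEFin.
have mI i : measurable_fun setT
    (\1_[set x | ball_type e r x (rep i)] : gr_node G -> R).
  by apply: measurable_indic; exact: measurable_gr_ball_type.
rewrite ge0_integral_sum //; last first.
  by move=> i; apply/measurable_EFinP; apply: measurable_funM.
rewrite -sumEFin; apply: eq_bigr => i _.
under eq_integral do rewrite EFinM.
rewrite ge0_integralZl_EFin //; last exact/measurable_EFinP.
rewrite integral_indic // ?setIT; last exact: measurable_gr_ball_type.
rewrite EFinM /gr_ball_prob fineK // fin_num_measure //.
exact: measurable_gr_ball_type.
Qed.

End representatives.

Lemma gr_representatives r : exists (I : finType) (rep : I -> rooted_graph),
  represents_balls rep e r.
Proof.
have [I [rep hrep]] := ball_type_indices (D.+1 ^ r).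
exists I, rep; apply: hrep.
- exact: gr_adj_sym.
- exact: gr_adj_irr.
- exact: finite_graph_ball gr_small_adj r.
- exact: ball_order_bound gr_small_adj r.
Qed.

(** This is the pointwise limit of the measurable reciprocals of ball orders, the error at radius
    [r] being at most [rad R r]. *)
Lemma measurable_component_inv : measurable_fun setT
  (fun x => fine (counting (component e x))^-1%E : R).
Proof.
apply: (@measurable_fun_cvg _ _ _ _ (fun r x => (ball_order e r x)%:R^-1)).
  by move=> r; have [I [rep hrep]] := gr_representatives r;
    exact: measurable_ball_order_inv hrep.
move=> x _; set c := fine _.
apply: (@squeeze_cvgr _ _ _ _ (fun=> c) (fun r => c + rad R r)).
- by near=> r; have [_ _ cl cr] := gr_component_fine r x; rewrite cl cr.
- exact: cvg_cst.
- rewrite -[X in _ --> X]addr0; apply: cvgD; first exact: cvg_cst.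
  exact: cvg_harmonic.
Unshelve. all: by end_near.
Qed.

(** Integrate the pointwise bounds of [gr_component_fine]; the constant [rad R r] integrates to
    itself against a probability. *)
Lemma total_rank_approx (I : finType) (rep : I -> rooted_graph) r :
  represents_balls rep e r ->
  `|total_rank G -
    (1 - \sum_i (rg_order (rep i))%:R^-1 * gr_ball_prob G r (rep i))| <= rad R r.
Proof.
move=> hrep; set a := \sum_i _.
pose c x := fine (counting (component e x))^-1%E : R.
have aE := integral_ball_order_inv hrep; rewrite -/a in aE.
have c_ge0 x : 0 <= c x by have [] := gr_component_fine 0 x.
have mc : measurable_fun setT (fun x => (c x)%:E).
  exact/measurable_EFinP/measurable_component_inv.
have mb : measurable_fun setT (fun x => ((ball_order e r x)%:R^-1 : R)%:E).
  exact/measurable_EFinP/(measurable_ball_order_inv hrep).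
have -> : total_rank G = 1 - fine (\int[P]_u (c u)%:E)%E.
  congr (1 - fine _); apply: eq_integral => u _.
  by have [-> _ _ _] := gr_component_fine 0 u.
have c_le : (\int[P]_u (c u)%:E <= a%:E)%E.
  rewrite -aE; apply: ge0_le_integral => //.
    by move=> x _; rewrite lee_fin.
  by move=> x _; rewrite lee_fin; have [] := gr_component_fine r x.
have le_c : (a%:E <= \int[P]_u (c u)%:E + (rad R r)%:E)%E.
  have -> : (rad R r)%:E = (\int[P]_u (cst (rad R r)%:E u))%E.
    rewrite integral_cst // -[LHS]mule1; congr (_ * _)%E.
    exact/esym/probability_setT.
  rewrite -ge0_integralD //; last 2 first.
  - by move=> x _; rewrite lee_fin.
  - by move=> x _; rewrite /= lee_fin ltW ?rad_gt0.
  rewrite -aE; apply: ge0_le_integral => //.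
  - exact: emeasurable_funD.
  - by move=> x _ /=; rewrite -EFinD lee_fin; have [] := gr_component_fine r x.
have ge0_c : (0 <= \int[P]_u (c u)%:E)%E.
  by apply: integral_ge0 => x _; rewrite lee_fin.
(* The bounds [0] and [a] exclude infinite values, so [fine] returns the integral itself. *)
move: c_le le_c ge0_c; case: (\int[P]_u (c u)%:E)%E => [s||] //=.
rewrite -EFinD !lee_fin => sa as_ _; rewrite ler_norml; apply/andP; split; lra.
Qed.

End graphings.

(** * Sampling *)

Section finite_chebyshev.
Context (R : realFieldType) (I : finType) (p v : I -> R) (k : nat).
Hypothesis p_ge0 : forall i, 0 <= p i.
Hypothesis p_sum : \sum_i p i = 1.
Hypothesis v01 : forall i, 0 <= v i <= 1.
Let mean := \sum_i p i * v i.

Let mean01 : 0 <= mean <= 1.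
Proof.
apply/andP; split; first by apply: sumr_ge0 => i _; have /andP[? _] := v01 i; rewrite mulr_ge0.
rewrite -p_sum; apply: ler_sum => i _; have /andP[_ ?] := v01 i.
by rewrite ler_piMr.
Qed.

Let a i := v i - mean.

Let a_sum0 : \sum_i p i * a i = 0.
Proof.
under eq_bigr do rewrite mulrBr.
by rewrite sumrB -mulr_suml p_sum mul1r subrr.
Qed.

Let a_sqr_le1 i : a i * a i <= 1.
Proof.
have /andP[? ?] := v01 i; have /andP[? ?] := mean01.
have : `|a i| <= 1 by rewrite ler_norml /a; apply/andP; split; lra.
by rewrite -expr2 -real_normK ?num_real // expr_le1.
Qed.

(** The variance of a sum of [k] independent draws: cross terms factor and vanish because [a] has
    mean 0, and each of the [k] diagonal terms is at most 1. *)
Lemma sum_prod_sqr_dev : \sum_(t : {ffun 'I_k -> I})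
  (\prod_l p (t l)) * (\sum_i a (t i)) ^+ 2 <= k%:R.
Proof.
(* The factor contributed by draw [l] to the expectation of [a (t i) * a (t j)]. *)
pose F (i j l : 'I_k) x := p x * (if l == i then a x else 1) * (if l == j then a x else 1).
have FE i j : \sum_(t : {ffun 'I_k -> I}) (\prod_l p (t l)) * (a (t i) * a (t j))
    = \prod_l \sum_x F i j l x.
  rewrite bigA_distr_bigA; apply: eq_bigr => t _; rewrite /F !big_split /= mulrA.
  by congr (_ * _ * _); rewrite -big_mkcond /= big_pred1_eq.
have -> : \sum_(t : {ffun 'I_k -> I}) (\prod_l p (t l)) * (\sum_i a (t i)) ^+ 2
    = \sum_i \sum_j \prod_l \sum_x F i j l x.
  under eq_bigr do rewrite expr2 big_distrlr /= mulr_sumr.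
  rewrite exchange_big /=; apply: eq_bigr => i _.
  under eq_bigr do rewrite mulr_sumr.
  by rewrite exchange_big /=; apply: eq_bigr => j _; exact: FE.
rewrite (_ : k%:R = \sum_(i < k) 1); last by rewrite sumr_const card_ord.
apply: ler_sum => i _; rewrite (bigD1 i) //= [X in _ + X]big1 ?addr0; last first.
  move=> j ji; rewrite (bigD1 i) //= (_ : \sum_x _ = 0) ?mul0r //.
  under eq_bigr do rewrite /F eqxx eq_sym (negbTE ji) mulr1.
  exact: a_sum0.
rewrite (bigD1 i) //= [X in _ * X]big1 ?mulr1; last first.
  move=> l li; under eq_bigr do rewrite /F (negbTE li) !mulr1.
  exact: p_sum.
rewrite -p_sum; apply: ler_sum => x _.
by rewrite /F eqxx -mulrA ler_piMr.
Qed.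

(** Markov's inequality for the squared deviation of the sum, which is at least
    [(k%:R * delta) ^+ 2] on the event and has mean at most [k%:R]. *)
Lemma finite_chebyshev (delta : R) : (0 < k)%N -> 0 < delta ->
  \sum_(t : {ffun 'I_k -> I} | delta <= `|(\sum_i v (t i)) / k%:R - mean|)
    \prod_l p (t l) <= (k%:R * delta ^+ 2)^-1.
Proof.
move=> k0 d0; have k0' : 0 < k%:R :> R by rewrite ltr0n.
have kd0 : 0 < k%:R * delta by rewrite mulr_gt0.
have prod_ge0 (t : {ffun 'I_k -> I}) : 0 <= \prod_l p (t l) by apply: prodr_ge0.
apply: (@le_trans _ _ (((k%:R * delta) ^+ 2)^-1 * k%:R)); last first.
  rewrite exprMn [X in X * _]invfM mulrAC -mulrA expr2 invfM.
  by rewrite -mulrA [X in _ * X]mulrA mulVf ?gt_eqF // mul1r -invfM.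
rewrite ler_pdivlMl; last by rewrite exprn_gt0.
apply: le_trans sum_prod_sqr_dev; rewrite mulr_sumr big_mkcond /=.
apply: ler_sum => t _; case: ifP => [far|_]; last by rewrite mulr_ge0 // sqr_ge0.
rewrite mulrC ler_wpM2l //.
have -> : \sum_i a (t i) = k%:R * ((\sum_i v (t i)) / k%:R - mean).
  rewrite mulrBr mulrCA divff ?gt_eqF // mulr1 /a sumrB sumr_const card_ord.
  by rewrite mulr_natl.
rewrite !exprMn ler_wpM2l ?sqr_ge0 //.
rewrite -[leRHS]real_normK ?num_real // lerXn2r // nnegrE ltW //.
Qed.

End finite_chebyshev.

Lemma finite_setU_le (R : realType) (d : measure_display) (W : measurableType d)
    (P : probability W R) (J : finType) (Q : pred J) (F : J -> set W) :
  (forall t, measurable (F t)) ->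
  (P (\bigcup_(t in [set` Q]) F t) <= \sum_(t | Q t) P (F t))%E.
Proof.
move=> mF; rewrite bigcup_pred.
suff [] : measurable (\big[setU/set0]_(t in Q) F t) /\
  (P (\big[setU/set0]_(t in Q) F t) <= \sum_(t in Q) P (F t))%E by [].
elim/big_rec2 : _ => [|t y A _ [mA PA]]; first by rewrite measure0.
split; first exact: measurableU.
by apply: le_trans (measureU2 _ _ _) _ => //; rewrite leeD2l.
Qed.

(** * Estimability and local convergence *)

Section finite_graphs.
Context (R : realType) (G : fin_graph) (D : nat).
Hypothesis degD : fg_deg_le G D.
Local Notation e := (@fg_adj G).

Lemma fg_small_adj x : small D [set y | e x y].
Proof.
exists (enum [pred y | e x y]); rewrite -cardE; split; first exact: degD.
by move=> y exy; rewrite mem_enum.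
Qed.

Lemma fg_component_inv r x : exists c : R,
  [/\ c = (#|connect e x|%:R)^-1, 0 <= c,
      c <= (ball_order e r x)%:R^-1 & (ball_order e r x)%:R^-1 <= c + rad R r].
Proof.
have [c [+ c0 cl cr]] := component_order_approx fg_small_adj R r x.
have [||fc cE] := @card_uniq_seq _ (component e x) (enum (connect e x)).
- exact: enum_uniq.
- move=> y; rewrite mem_enum; split=> [[p [pp pE]]|/connectP[p pp ->]]; last by exists p.
  by apply/connectP; exists p.
rewrite /counting asboolT // cE -cardE inver pnatr_eq0.
have /negbTE -> : #|connect e x| != 0%N.
  by rewrite -lt0n; apply/card_gt0P; exists x; exact: connect0.
by move=> [cE']; exists c.
Qed.

Lemma fg_total_rank_approx (I : finType) (rep : I -> rooted_graph) r :
  represents_balls rep e r ->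
  `|fg_total_rank R G -
    (1 - \sum_i (rg_order (rep i))%:R^-1 * fg_ball_prob R G r (rep i))| <= rad R r.
Proof.
move=> hrep; have n0 : 0 < #|fg_node G|%:R :> R by rewrite ltr0n fg_node_gt0.
have -> : \sum_i (rg_order (rep i))%:R^-1 * fg_ball_prob R G r (rep i) =
    (\sum_(x : fg_node G) (ball_order e r x)%:R^-1) / #|fg_node G|%:R.
  under [in RHS]eq_bigr do rewrite (ball_order_inv_sum R hrep).
  rewrite exchange_big mulr_suml; apply: eq_bigr => i _.
  rewrite /fg_ball_prob mulrA -mulr_sumr; congr (_ * _ / _).
  rewrite -sum1_card natr_sum big_mkcond /=; apply: eq_bigr => x _.
  by rewrite inE /=; case: asboolP.
have cl (x : fg_node G) : (#|connect e x|%:R)^-1 <= (ball_order e r x)%:R^-1 :> R.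
  by have [c [<- _ ? _]] := fg_component_inv r x.
have cr (x : fg_node G) :
    (ball_order e r x)%:R^-1 <= (#|connect e x|%:R)^-1 + rad R r :> R.
  by have [c [<- _ _ ?]] := fg_component_inv r x.
rewrite /fg_total_rank.
set s := \sum_u _; set t := \sum_x _.
have st : s <= t by apply: ler_sum => x _; exact: cl.
have ts : t <= s + rad R r * #|fg_node G|%:R.
  rewrite /s /t mulr_natr -sumr_const -big_split /=.
  by apply: ler_sum => x _; exact: cr.
rewrite (_ : 1 - s / #|fg_node G|%:R - (1 - t / #|fg_node G|%:R) =
    (t - s) / #|fg_node G|%:R); last by rewrite mulrBl; lra.
rewrite ger0_norm ?divr_ge0 ?subr_ge0 ?ler0n // ler_pdivrMr //; lra.
Qed.
End finite_graphs.

(** The estimate is 1 minus the average reciprocal order of the sampled balls. Half of [eps] pays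
    for truncation at radius [r], half for the sampling error. *)
Theorem locally_estimable_total_rank (R : realType) :
  locally_estimable (@total_rank R).
Proof.
move=> eps D eps0.
have delta0 : 0 < eps / 2 by rewrite divr_gt0.
(* With [k = k'.+1] samples, the Chebyshev bound for a deviation of [eps / 2] falls below [eps]. *)
have [k' hk] := rad_lt (mulr_gt0 eps0 (exprn_gt0 2 delta0)).
have [r' hr'] := rad_lt delta0.
pose k := k'.+1; pose r := r'.+1.
have hr : rad R r < eps / 2.
  by apply: le_lt_trans hr'; rewrite /rad lef_pV2 ?posrE ?ltr0n // ler_nat.
(* All members of a ball type have the same order, so any of them may be read; the value 0 only
   covers the empty set, which is not the type of a ball here. *)
pose val (S : set rooted_graph) : R :=
  if pselect (exists K, S K) is left SK then (rg_order (projT1 (cid SK)))%:R^-1 else 0.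
exists k, r, (fun S => 1 - (\sum_i val (S i)) / k%:R); split=> // G degD d W P X [idX indX].
have [I [rep hrep]] := gr_representatives degD r.
pose A i := [set x | ball_type (@gr_adj R G) r x (rep i)].
have mA i : measurable (A i) by exact: measurable_gr_ball_type degD _ _.
pose p i := gr_ball_prob G r (rep i).
pose v i : R := (rg_order (rep i))%:R^-1.
have pE i : @gr_prob R G (A i) = (p i)%:E.
  by rewrite /p /gr_ball_prob fineK //; apply: fin_num_measure; exact: mA.
have p0 i : 0 <= p i by rewrite -lee_fin -pE measure_ge0.
have v01 i : 0 <= v i <= 1.
  rewrite invr_ge0 ler0n invf_le1 ?ltr0n ?ler1n //;
  exact: leq_ltn_trans (ltn_ord (rg_root (rep i))).
have p1 : \sum_i p i = 1.
  apply: EFin_inj; rewrite -sumEFin.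
  under eq_bigr do rewrite -pE.
  have tA : trivIset setT A.
    apply/trivIsetP => i j _ _ ij; rewrite -subset0 => x [xi xj].
    have [l _ uni] := hrep x.
    by move/eqP: ij; apply; rewrite (uni i xi) (uni j xj).
  rewrite (fsbig_seq _ _ (index_enum_uniq I)).
  rewrite -measure_fin_bigcup //; last by apply: sub_trivIset tA.
  rewrite (_ : \bigcup_(i in _) _ = setT); first exact: probability_setT.
  by apply/seteqP; split=> // x _; have [i xi _] := hrep x; exists i => //=; rewrite mem_index_enum.
pose Q := [pred t : {ffun 'I_k -> I} | eps <=
  `|1 - (\sum_i v (t i)) / k%:R - total_rank G|].
(* The event that the sampled balls have types [t]. The estimate is constant on each cell, so the
   bad event is a finite union of cells, whose probabilities are products by independence. *)
pose cell (t : {ffun 'I_k -> I}) := \bigcap_i (X i @^-1` A (t i)).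
have valE x i : A i x -> val (ball_type (@gr_adj R G) r x) = v i.
  move=> Ai; rewrite /val /v; case: pselect => [xK|[]]; last by exists (rep i).
  by case: cid => K /= /ball_type_order <-; rewrite (ball_type_order Ai).
have mcell t : measurable (cell t).
  apply: fin_bigcap_measurable; first exact: finite_finset.
  move=> i _; rewrite -[_ @^-1` _]setTI; exact: (measurable_funPT (X i)).
rewrite (_ : mkset _ = \bigcup_(t in [set` Q]) cell t); last first.
  apply/seteqP; split=> w /=.
    move=> far; have /choice[i hi] j : exists i, A i (X j w).
      by have [i ? _] := hrep (X j w); exists i.
    exists (finfun i); last by move=> j _ /=; rewrite ffunE.
    rewrite /= inE; move: far; under eq_bigr do rewrite (valE _ _ (hi _)).
    by under [in X in _ -> X]eq_bigr do rewrite ffunE.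
  move=> [t]; rewrite /= inE => far tw.
  by under eq_bigr do rewrite (valE _ (t _) (tw _ Logic.I)).
apply: le_trans (finite_setU_le P Q mcell) _.
have cellE t : P (cell t) = (\prod_l p (t l))%:E.
  rewrite indX // (big_morph EFin (@EFinM R) erefl); apply: eq_bigr => l _.
  by rewrite -pE -(idX l).
under eq_bigr do rewrite cellE.
rewrite sumEFin lee_fin.
have := finite_chebyshev p0 p1 v01 (ltn0Sn k') delta0; rewrite -/k.
set mean := \sum_i p i * v i => cheb.
have trE : `|total_rank G - (1 - mean)| <= rad R r.
  rewrite /mean; under eq_bigr do rewrite mulrC.
  exact: total_rank_approx degD _ _ _ hrep.
(* Since truncation costs less than [eps / 2], an error of at least [eps] forces the sample average
   to deviate from [mean] by at least [eps / 2]. *)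
apply: le_trans (le_trans cheb _).
  rewrite big_mkcond [leRHS]big_mkcond /=; apply: ler_sum => t _.
  have pr0 : 0 <= \prod_l p (t l) by apply: prodr_ge0.
  case: ifP => [|_]; last by case: ifP.
  move=> /= far; case: ifPn => // /negP[].
  set s := _ / _ in far *.
  have := ler_distD (1 - mean) (1 - s) (total_rank G).
  rewrite (distrC (1 - mean) (total_rank G)).
  rewrite (_ : 1 - s - (1 - mean) = - (s - mean)) ?normrN; last by lra.
  lra.
rewrite invfM -/(rad R k') ler_pdivrMr ?exprn_gt0 //.
exact: ltW.
Qed.

(** At a fixed radius both truncation errors are below [eps / 4] uniformly in [n], and the truncated
    ranks converge as finite combinations of ball probabilities. *)
Lemma total_rank_cvg (R : realType) (D : nat) (Gs : nat -> fin_graph) (G : graphing R) :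
  (forall n, fg_deg_le (Gs n) D) -> locally_converges Gs G ->
  fg_total_rank R (Gs n) @[n --> \oo] --> total_rank G.
Proof.
move=> degGs cvgG; have [D' degG] := gr_bounded_deg G.
apply/cvgrPdist_lt => eps eps0.
have [r' hr'] := rad_lt (divr_gt0 eps0 (ltr0n _ 4)); pose r := r'.+1.
have hr : rad R r < eps / 4.
  by apply: le_lt_trans hr'; rewrite /rad lef_pV2 ?posrE ?ltr0n // ler_nat.
(* The graphing has its own degree bound [D']; the maximum bounds ball orders in it and in all the
   [Gs n]. *)
have [I [rep hrep]] := ball_type_indices (maxn (D.+1 ^ r) (D'.+1 ^ r)).
have repG : represents_balls rep (@gr_adj R G) r.
  apply: hrep => [||x|x].
  - exact: gr_adj_sym.
  - exact: gr_adj_irr.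
  - exact: finite_graph_ball (gr_small_adj degG) r x.
  - apply: leq_trans (leq_maxr _ _).
    exact: ball_order_bound (gr_small_adj degG) r x.
have repGs n : represents_balls rep (@fg_adj (Gs n)) r.
  apply: hrep => [||x|x].
  - exact: fg_adj_sym.
  - exact: fg_adj_irr.
  - exact: finite_graph_ball (fg_small_adj (degGs n)) r x.
  - apply: leq_trans (leq_maxl _ _).
    exact: ball_order_bound (fg_small_adj (degGs n)) r x.
have lim : \sum_i (rg_order (rep i))%:R^-1 * fg_ball_prob R (Gs n) r (rep i)
    @[n --> \oo] --> \sum_i (rg_order (rep i))%:R^-1 * gr_ball_prob G r (rep i).
  apply: cvg_big => [|i _]; first exact: add_continuous.
  apply: cvgM; first exact: cvg_cst.
  exact: cvgG.
have /cvgrPdist_lt/(_ _ (divr_gt0 eps0 (ltr0n _ 4))) := lim.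
apply: filterS => n.
have := total_rank_approx degG repG.
have := fg_total_rank_approx R (degGs n) (repGs n).
rewrite !ler_norml !ltr_norml => /andP[? ?] /andP[? ?] /andP[? ?].
by apply/andP; split; lra.
Qed.

Theorem theorem4p7 (R : realType) :
  locally_estimable (@total_rank R) /\
  (forall (D : nat) (Gs : nat -> fin_graph) (G : graphing R),
     (forall n, fg_deg_le (Gs n) D) ->
     locally_converges Gs G ->
     fg_total_rank R (Gs n) @[n --> \oo] --> total_rank G).
Proof.
by split; [exact: locally_estimable_total_rank|exact: total_rank_cvg].
Qed.
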